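(* Let $X=(X_1,X_2,\ldots)\in\mathcal{L}$ with $\nu$, $\theta$, $K$ as in the definition of $\mathcal{L}$, and let $\mu$ be a random probability measure on $(S,\mathcal{B})$ such that, for each fixed $A\in\mathcal{B}$, $$\mu(A)\overset{a.s.}=\lim_n\frac1n\sum_{i=1}^n1_A(X_i)\overset{a.s.}=\lim_nP\bigl(X_{n+1}\in A\mid\mathcal{F}_n\bigr).$$ For each $n\ge1$, let $V^{(n)}=(V^{(n)}_j:j\ge1)$ and $Z^{(n)}=(Z^{(n)}_j:j\ge1)$ be two sequences such that: (i) $V^{(n)}$ and $Z^{(n)}$ are conditionally independent given $\mathcal{F}_n$; (ii) $V^{(n)}$ has the stick-breaking distribution with parameter $n+\theta$ conditionally on $\mathcal{F}_n$; (iii) $Z^{(n)}$ is i.i.d. conditionally on $\mathcal{F}_n$ with $$P\bigl(Z^{(n)}_1\in\cdot\mid\mathcal{F}_n\bigr)=P\bigl(X_{n+1}\in\cdot\mid\mathcal{F}_n\bigr)=\frac{\theta\,\nu(\cdot)+\sum_{i=1}^nK(X_i)(\cdot)}{n+\theta}\quad\text{a.s.}$$ Let $\mu^*_n=\sum_jV^{(n)}_j\,K\bigl(Z^{(n)}_j\bigr)$. Then $$P(\mu\in C\mid\mathcal{F}_n)=P(\mu^*_n\in C\mid\mathcal{F}_n)\quad\text{a.s. for all }C\in\mathcal{C}\text{ and }n\ge1.$$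
   Context: $S$ is a Borel subset of a Polish space and $\mathcal{B}$ is its Borel $\sigma$-field. All random elements are defined on a probability space $(\Omega,\mathcal{A},P)$, and $\mathcal{F}_n=\sigma(X_1,\ldots,X_n)$. $\mathcal{P}$ is the set of all probability measures on $\mathcal{B}$, and $\mathcal{C}$ is the $\sigma$-field on $\mathcal{P}$ generated by the maps $p\mapsto p(A)$, $A\in\mathcal{B}$. A kernel on $(S,\mathcal{B})$ is a measurable map $K:(S,\mathcal{B})\to(\mathcal{P},\mathcal{C})$; $K(x)(A)$ is the value of $K(x)$ at $A$. A random probability measure on $(S,\mathcal{B})$ is a measurable map $(\Omega,\mathcal{A})\to(\mathcal{P},\mathcal{C})$. $K$ is a regular conditional distribution for $\nu\in\mathcal{P}$ given a sub-$\sigma$-field $\mathcal{G}\subset\mathcal{B}$ if $K(x)\in\mathcal{P}$ for each $x\in S$, $x\mapsto K(x)(A)$ is $\mathcal{G}$-measurable for each $A\in\mathcal{B}$, and $\nu(A\cap G)=\int_GK(x)(A)\,\nu(dx)$ for all $A\in\mathcal{B}$, $G\in\mathcal{G}$. $\mathcal{L}$ is the class of all sequences $X=(X_1,X_2,\ldots)$ of $S$-valued random variables for which there are $\nu\in\mathcal{P}$, a constant $\theta>0$ and a kernel $K$ which is a regular conditional distribution for $\nu$ given some sub-$\sigma$-field $\mathcal{G}\subset\mathcal{B}$, such that $X_1\sim\nu$ and $P(X_{n+1}\in\cdot\mid\mathcal{F}_n)=\frac{\theta\nu(\cdot)+\sum_{i=1}^nK(X_i)(\cdot)}{n+\theta}$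 a.s. for all $n\ge1$. Each $X\in\mathcal{L}$ is exchangeable, so a random probability measure $\mu$ as in the claim exists. A sequence $(V_n)$ has the stick-breaking distribution with parameter $\alpha>0$ if it is distributed as $(T_n)$, where $T_1=W_1$, $T_n=W_n\prod_{i=1}^{n-1}(1-W_i)$ for $n>1$, and $(W_n)$ is i.i.d. with $W_1\sim\mathrm{beta}(1,\alpha)$. *)

(* Defs.v *)
From HB Require Import structures.
From mathcomp Require Import all_boot all_order all_algebra finmap.
From mathcomp Require Import all_classical all_reals all_analysis measurable_realfun.

Set Implicit Arguments.
Unset Strict Implicit.
Unset Printing Implicit Defensive.
Import Order.TTheory GRing.Theory Num.Theory.
Import numFieldNormedType.Exports.
Local Open Scope classical_set_scope.
Local Open Scope ring_scope.

Definition polish (R : realType) (T : topologicalType) : Prop :=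
  (exists2 D : set T, countable D & dense D) /\
  exists dist : T -> T -> R,
    [/\ (forall x y, 0 <= dist x y) /\ (forall x y, dist x y = 0 <-> x = y),
        forall x y, dist x y = dist y x,
        forall x y z, dist x z <= dist x y + dist y z,
        forall (x : T) (A : set T),
          nbhs x A <-> exists2 e, 0 < e & [set y | dist x y < e] `<=` A &
        forall u : nat -> T,
          (forall e, 0 < e -> exists N, forall m n,
             (N <= m)%N -> (N <= n)%N -> dist (u m) (u n) < e) ->
          exists x : T, u @ \oo --> x].

(* The measurable space carried by a subset S of a topological space: S as a
   type, with the Borel sigma-field of its subspace topology.  Since library
   measurable types are pointed, a point of S has to be supplied; it plays no
   other role, and S is nonempty as soon as there is an S-valued map. *)
Definition pointed_subset (T : topologicalType) (S : set T) (s0 : set_type S)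
  : Type := set_type S.

HB.instance Definition _ (T : topologicalType) (S : set T) (s0 : set_type S) :=
  Topological.copy (pointed_subset s0) (set_type S).
HB.instance Definition _ (T : topologicalType) (S : set T) (s0 : set_type S) :=
  isPointed.Build (pointed_subset s0) s0.

Definition borel_subset (T : topologicalType) (S : set T) (s0 : set_type S) :=
  g_sigma_algebraType (@open (pointed_subset s0)).

Definition sigma_family d (T : measurableType d) (U : Type) (I : set nat)
    (Y : nat -> U -> T) : set (set U) :=
  <<s \bigcup_(i in I) preimage_set_system setT (Y i) measurable >>.

Definition product_sigma d (T : measurableType d) : set (set (nat -> T)) :=
  sigma_family setT (fun j (x : nat -> T) => x j).

Definition measurable_wrt d (T : measurableType d) (U : Type)
    (G : set (set U)) (f : U -> T) : Prop :=
  preimage_set_system setT f measurable `<=` G.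

Section conditioning.
Context d (Om : measurableType d) (R : realType) (P : probability Om R).

(* f is a version of P(E | G), for a sub-sigma-field G.  An a.s. equality
   P(E | G) = f with f real-valued and G-measurable is stated in this form. *)
Definition cond_prob (G : set (set Om)) (E : set Om) (f : Om -> R) : Prop :=
  [/\ measurable_wrt G f, P.-integrable setT (EFin \o f) &
      forall H, G H -> (\int[P]_(w in H) (f w)%:E = P (E `&` H))%E].

Definition cond_indep_sigma (G A1 A2 : set (set Om)) : Prop :=
  forall E1 E2 f1 f2, A1 E1 -> A2 E2 ->
    cond_prob G E1 f1 -> cond_prob G E2 f2 ->
    cond_prob G (E1 `&` E2) (fun w => f1 w * f2 w).

Definition cond_mutual_indep d' (T : measurableType d') (G : set (set Om))
    (Y : nat -> Om -> T) : Prop :=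
  forall (J : {fset nat}) (B : nat -> set T) (f : nat -> Om -> R),
    (forall j, measurable (B j)) ->
    (forall j, cond_prob G (Y j @^-1` B j) (f j)) ->
    cond_prob G (\bigcap_(j in [set` J]) (Y j @^-1` B j))
      (fun w => \prod_(j <- J) f j w).

Definition mutual_indep d' (T : measurableType d') (Y : nat -> Om -> T) : Prop :=
  forall (J : {fset nat}) (B : nat -> set T),
    (forall j, measurable (B j)) ->
    fine (P (\bigcap_(j in [set` J]) (Y j @^-1` B j))) =
    \prod_(j <- J) fine (P (Y j @^-1` B j)).

End conditioning.

(* The library's beta_prob only has natural number parameters.  The integrals
   are over the open interval to avoid the value of powR at 0. *)
Definition beta_law (R : realType) (a b : R) (U : set R) : R :=
  let h := fun x : R => x `^ (a - 1) * (1 - x) `^ (b - 1) in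
  (\int[lebesgue_measure]_(x in U `&` `]0, 1[) h x) /
  (\int[lebesgue_measure]_(x in `]0, 1[) h x).

Definition stick_breaking (R : realType) (W : nat -> R) : nat -> R :=
  fun n => W n * \prod_(i < n) (1 - W i).

Definition stick_breaking_law (R : realType) (alpha : R)
    (L : set (nat -> R) -> R) : Prop :=
  exists (d : measure_display) (Om : measurableType d) (P : probability Om R)
         (W : nat -> {RV P >-> R}),
    [/\ mutual_indep P W,
        forall j U, measurable U ->
          P (W j @^-1` U) = (beta_law 1 alpha U)%:E &
        forall B, product_sigma B ->
          L B = fine (P [set w | B (stick_breaking (fun j => W j w))])].

Section kernels.
Context d (S : measurableType d) (R : realType).

Definition regular_cond_distr (nu : probability S R) (G : set (set S))
    (K : S -> probability S R) : Prop :=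
  (forall A, measurable A -> measurable_wrt G (fun x => K x A)) /\
  (forall A H, measurable A -> G H ->
    (nu (A `&` H) = \int[nu]_(x in H) K x A)%E).

(* The probability measure sum_j v_j q_j.  The value when v is not a sequence
   of weights, i.e. nonnegative with sum 1, is irrelevant: for v distributed
   by a stick-breaking law this is a null event. *)
Definition mixture (v : nat -> R) (q : nat -> probability S R)
  : probability S R :=
  xget (q 0%N) [set p : probability S R | (forall j, 0 <= v j) /\
    forall A, measurable A -> (p A = \sum_(0 <= j <oo) (v j)%:E * q j A)%E].

Lemma mixtureE (v : nat -> R) (q : nat -> probability S R) (A : set S) :
  (forall j, 0 <= v j) -> (\sum_(0 <= j <oo) (v j)%:E = 1)%E ->
  measurable A ->
  (mixture v q A = \sum_(0 <= j <oo) (v j)%:E * q j A)%E.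
Proof.
move=> v0 v1 mA.
pose m : {measure set S -> \bar R} :=
  mseries (fun j => mscale (NngNum (v0 j)) (q j)) 0.
have mT : m setT = 1%E.
  rewrite /m /= /mseries -v1; apply: eq_eseriesr => j _.
  by rewrite /= /mscale /= probability_setT mule1.
have ex : exists p : probability S R, (forall j, 0 <= v j) /\
    forall A, measurable A -> (p A = \sum_(0 <= j <oo) (v j)%:E * q j A)%E.
  exists (mnormalize m (q 0%N)); split=> // B mB.
  by rewrite /= /mnormalize mT onee_eq0 /= invr1 mule1.
rewrite /mixture; case: xgetP => [p _ [_]|nex]; first exact.
by case: ex => p /nex.
Qed.

Section predictive.
Context d' (Om : measurableType d') (P : probability Om R).
Variables (nu : probability S R) (theta : R) (K : S -> probability S R).
Variable X : nat -> Om -> S.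

(* Sequences are indexed from 0: X 0 is X_1, and sigma_family `I_n X is
   F_n = sigma(X_1, ..., X_n). *)
Definition predictive (n : nat) (w : Om) (A : set S) : R :=
  (theta * fine (nu A) + \sum_(i < n) fine (K (X i w) A)) / (n%:R + theta).

Definition class_L : Prop :=
  [/\ 0 < theta,
      exists G, [/\ sigma_algebra setT G, G `<=` measurable &
                    regular_cond_distr nu G K],
      forall A, measurable A -> P (X 0%N @^-1` A) = nu A &
      forall n A, (0 < n)%N -> measurable A ->
        cond_prob P (sigma_family `I_n X) (X n @^-1` A)
          (fun w => predictive n w A)].

End predictive.
End kernels.

(* Main.v *)
Require Import Defs.
From HB Require Import structures.
From mathcomp Require Import all_boot all_order all_algebra finmap.
From mathcomp Require Import all_classical all_reals all_analysis measurable_realfun unstable.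
From mathcomp Require Import ring lra.
Import Order.TTheory GRing.Theory Num.Theory.
Import numFieldNormedType.Exports.
Set Implicit Arguments.
Unset Strict Implicit.
Unset Printing Implicit Defensive.
Local Open Scope classical_set_scope.
Local Open Scope ring_scope.

(** Let [h] be a nonnegative combination of functions [x |-> K x A].  Since K is
    a regular conditional distribution given G, K x B = 1_B x for B in G and
    nu-almost all x, so on G-measurable functions the predictive distributions
    are those of a Polya urn: with the power sums
    [p_j = theta nu(h^j) + \sum_(i < n) h(X_i)^j] one has
    [E(h(X_n)^j | F_n) = p_j / (n + theta)].

    Let [a_k] be obtained from the [p_j] by Newton's identity
    [k a_k = \sum_(1 <= j <= k) p_j a_(k-j)], and let
    [m_k = k! a_k / ((al) (al + 1) ... (al + k - 1))] with [al = n + theta].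
    Adding one observation y multiplies [\sum_k a_k s^k] by [1 / (1 - y s)], and
    therefore [m_k] is a martingale in n; it converges to [mu(h)^k], so
    [E(mu(h)^k | F_n) = m_k].  On the other side, the stick-breaking sum
    [D = \sum_j V_j h(Z_j)] satisfies [D = W h(Z) + (1 - W) D'] with D' a copy of
    D, and its conditional moments given F_n solve the same Newton recursion, so
    [E(D^k | F_n) = m_k] as well.

    Equality of the moments of all such mu(h) gives, by polarization, equality of
    the joint moments of [mu(A_1), ..., mu(A_r)], hence of their joint law
    (polynomials approximate indicators of intervals), hence of the law of mu by
    the pi-lambda theorem. *)

(** * Newton's identity and its limits *)

Definition rising {R : ringType} (x : R) k : R := \prod_(i < k) (x + i%:R).

Lemma rising0 (R : ringType) (x : R) : rising x 0 = 1.
Proof. by rewrite /rising big_ord0. Qed.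

Lemma risingS (R : ringType) (x : R) k : rising x k.+1 = rising x k * (x + k%:R).
Proof. by rewrite /rising big_ord_recr. Qed.

Lemma risingSl (R : comRingType) (x : R) k : rising x k.+1 = x * rising (x + 1) k.
Proof.
rewrite /rising big_ord_recl /= addr0; congr (_ * _); apply: eq_bigr => i _.
by rewrite /bump leq0n natrD addrA.
Qed.

Lemma rising_gt0 (R : realFieldType) (x : R) k : 0 < x -> 0 < rising x k.
Proof.
by move=> x0; rewrite /rising prodr_gt0// => i _; rewrite ltr_wpDr.
Qed.

Section newton.
Context {R : realFieldType}.
Implicit Types p q : nat -> R.

Fixpoint csym_rev p k : seq R :=
  if k is k'.+1 then
    ((\sum_(j < k'.+1) p j.+1 * (csym_rev p k')`_j) / k'.+1%:R) :: csym_rev p k'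
  else [:: 1].

(* The complete symmetric function of degree k, computed from the power sums p
   by Newton's identity [k a_k = \sum_(1 <= j <= k) p_j a_(k-j)]. *)
Definition csym p k : R := (csym_rev p k)`_0.

Lemma csym0 p : csym p 0 = 1. Proof. by []. Qed.

Lemma csym_revE p k j : (j <= k)%N -> (csym_rev p k)`_j = csym p (k - j).
Proof.
elim: k j => [|k IH] [|j]//; rewrite ltnS => jk.
by rewrite subSS -IH.
Qed.

Lemma csymS p k :
  k.+1%:R * csym p k.+1 = \sum_(j < k.+1) p j.+1 * csym p (k - j).
Proof.
rewrite {1}/csym /= mulrC divfK ?pnatr_eq0//; apply: eq_bigr => j _.
by rewrite csym_revE// -ltnS.
Qed.

Lemma csymE p k : p 0%N * csym p k + k%:R * csym p k =
  \sum_(i < k.+1) p i * csym p (k - i).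
Proof.
rewrite big_ord_recl subn0; congr (_ + _); case: k => [|k].
  by rewrite mul0r big_ord0.
by rewrite csymS; apply: eq_bigr => i _; rewrite subSS.
Qed.

Lemma csym_uniq p (b : nat -> R) : b 0%N = 1 ->
  (forall k, k.+1%:R * b k.+1 = \sum_(j < k.+1) p j.+1 * b (k - j)%N) ->
  b =1 csym p.
Proof.
move=> b0 bS k; elim/ltn_ind: k => -[|k] IH; first by rewrite b0.
apply: (@mulfI _ k.+1%:R); first by rewrite pnatr_eq0.
by rewrite bS csymS; apply: eq_bigr => j _; rewrite IH// ltnS leq_subr.
Qed.

Lemma csym_ge0 p k : (forall j, 0 <= p j) -> 0 <= csym p k.
Proof.
move=> p0; elim/ltn_ind: k => -[|k] IH; first by rewrite csym0 ler01.
rewrite -(@pmulr_rge0 _ k.+1%:R) ?ltr0n// csymS sumr_ge0// => j _.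
by rewrite mulr_ge0// IH// ltnS leq_subr.
Qed.

(* In generating function form, adding a variable y multiplies
   [\sum_k a_k s^k] by [1 / (1 - y s)]. *)
Lemma csym_add p (y : R) k :
  csym (fun j => p j + y ^+ j) k = \sum_(i < k.+1) y ^+ i * csym p (k - i).
Proof.
pose b k := \sum_(i < k.+1) y ^+ i * csym p (k - i).
rewrite -[RHS]/(b k); apply/esym; move: k; apply: csym_uniq.
  by rewrite /b big_ord1 expr0 mul1r.
have bS k : b k.+1 = csym p k.+1 + y * b k.
  rewrite /b big_ord_recl subn0 expr0 mul1r; congr (_ + _).
  by rewrite mulr_sumr; apply: eq_bigr => i _; rewrite subSS exprS mulrA.
elim=> [|k IH].
  by rewrite bS mulrDr csymS !big_ord1 /b big_ord1 subn0 csym0 !expr0 expr1; lra.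
pose c k := \sum_(j < k.+1) y ^+ j.+1 * b (k - j)%N.
have cS : c k.+1 = y * b k.+1 + y * c k.
  rewrite /c big_ord_recl subn0 expr1; congr (_ + _); rewrite mulr_sumr.
  by apply: eq_bigr => i _; rewrite subSS exprS mulrA.
have S' m : \sum_(j < m.+1) (p j.+1 + y ^+ j.+1) * b (m - j)%N =
    \sum_(j < m.+1) p j.+1 * b (m - j)%N + c m.
  by rewrite -big_split; apply: eq_bigr => j _; rewrite mulrDl.
have pS : \sum_(j < k.+2) p j.+1 * b (k.+1 - j)%N =
    k.+2%:R * csym p k.+2 + y * \sum_(j < k.+1) p j.+1 * b (k - j)%N.
  rewrite csymS [LHS]big_ord_recr [in RHS]big_ord_recr /= subnn csym0.
  have -> : b 0%N = 1 by rewrite /b big_ord1 expr0 mul1r.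
  rewrite [RHS]addrAC; congr (_ + _); rewrite mulr_sumr -big_split.
  apply: eq_bigr => j _; rewrite subSn; last by rewrite -ltnS.
  by rewrite bS /=; ring.
rewrite S' cS pS bS; move: IH; rewrite S' => IH.
have -> : k.+2%:R * csym p k.+2 + y * \sum_(j < k.+1) p j.+1 * b (k - j)%N +
   (y * b k.+1 + y * c k) = k.+2%:R * csym p k.+2 + y * b k.+1 + y * (k.+1%:R * b k.+1).
  by rewrite IH; ring.
have -> : k.+2%:R = k.+1%:R + 1 :> R by rewrite -natr1.
ring.
Qed.

End newton.

Lemma cvg_sumr (R : realType) (I : Type) (r : seq I) (f : I -> nat -> R) (l : I -> R) :
  (forall i, f i @ \oo --> l i) ->
  (fun N => \sum_(i <- r) f i N) @ \oo --> \sum_(i <- r) l i.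
Proof.
move=> fl; elim: r => [|i r IH].
  by rewrite big_nil; under eq_fun do rewrite big_nil; exact: cvg_cst.
by rewrite big_cons; under eq_fun do rewrite big_cons; exact: cvgD.
Qed.

Section csym_limits.
Context {R : realType}.

Lemma csym_asymptotic (al : nat -> R) (p : nat -> nat -> R) (x : R) k :
  (forall N, 0 < al N) -> (fun N => (al N)^-1) @ \oo --> 0 ->
  (forall N j, 0 <= p N j <= al N) -> (fun N => p N 1%N / al N) @ \oo --> x ->
  (fun N => csym (p N) k / al N ^+ k) @ \oo --> x ^+ k / k`!%:R.
Proof.
move=> al0 alV pal px; elim/ltn_ind: k => -[|k] IH.
  rewrite expr0 fact0 divr1; apply: cvg_near_cst; apply: nearW => N.
  by [].
have alN N : al N != 0 by rewrite gt_eqF.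
have step N : csym (p N) k.+1 / al N ^+ k.+1 =
    (\sum_(j < k.+1) (p N j.+1 / al N * (al N)^-1 ^+ j) *
       (csym (p N) (k - j) / al N ^+ (k - j))) / k.+1%:R.
  have -> : csym (p N) k.+1 = (\sum_(j < k.+1) p N j.+1 * csym (p N) (k - j)) / k.+1%:R.
    by rewrite -csymS mulrAC divff ?mul1r// pnatr_eq0.
  rewrite mulrAC; congr (_ / _); rewrite mulr_suml; apply: eq_bigr => j _.
  have -> : al N ^+ k.+1 = al N * al N ^+ j * al N ^+ (k - j).
    by rewrite -exprS -exprD addSn subnKC// -ltnS.
  by rewrite exprVn; field; rewrite !expf_neq0 ?alN.
under eq_fun do rewrite step.
have -> : x ^+ k.+1 / (k.+1)`!%:R =
    (\sum_(j < k.+1) (if j == ord0 then x * (x ^+ k / k`!%:R) else 0)) / k.+1%:R.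
  rewrite -big_mkcond big_pred1_eq exprS factS natrM invfM; ring.
pose f (j : 'I_k.+1) N := (p N j.+1 / al N * (al N)^-1 ^+ j) *
       (csym (p N) (k - j) / al N ^+ (k - j)).
pose l (j : 'I_k.+1) := if j == ord0 then x * (x ^+ k / k`!%:R) else 0.
apply: cvgMr_tmp; apply: (@cvg_sumr R _ _ f l) => j; rewrite /f /l.
have [{j}->|j0] := eqVneq j ord0.
  rewrite subn0 /=; under eq_fun do rewrite expr0 mulr1.
  by apply: cvgM => //; exact: IH.
have [j' jE] : exists j' : nat, j = j'.+1 :> nat.
  by case: j j0 => -[|j'] jk' /eqP j0; [case: j0; exact/val_inj|exists j'].
rewrite jE; have jk : (k - j'.+1 < k.+1)%N by rewrite ltnS leq_subr.
rewrite -[0](mul0r (x ^+ (k - j'.+1) / (k - j'.+1)`!%:R)).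
apply: cvgM; last exact: IH.
have z : (fun N => (al N)^-1 ^+ j'.+1) @ \oo --> 0.
  rewrite [X in _ --> X](_ : _ = (0 : R) ^+ j'.+1); last by rewrite expr0n.
  exact: (cvg_comp (fun N => (al N)^-1) (fun x : R => x ^+ j'.+1) alV
    (@exprn_continuous R j'.+1 0)).
apply/cvgr0Pnorm_lt => e e0.
have /cvgr0Pnorm_lt /(_ e e0) := z.
apply: filterS => N; apply: le_lt_trans; rewrite normrM ler_piMl//.
have /andP[p0 p1] := pal N j'.+2.
by rewrite ger0_norm ?ler_pdivrMr ?mul1r// divr_ge0// ltW.
Qed.

Lemma rising_asymptotic (al : nat -> R) k :
  (forall N, 0 < al N) -> (fun N => (al N)^-1) @ \oo --> 0 ->
  (fun N => rising (al N) k / al N ^+ k) @ \oo --> (1 : R).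
Proof.
move=> al0 alV; elim: k => [|k IH].
  by apply: cvg_near_cst; apply: nearW => N; rewrite rising0 expr0 divr1.
have -> : (fun N => rising (al N) k.+1 / al N ^+ k.+1) =
    (fun N => (rising (al N) k / al N ^+ k) * (1 + k%:R * (al N)^-1)).
  apply/funext => N; rewrite risingS exprS; field.
  by rewrite expf_neq0 gt_eqF.
rewrite -[X in _ --> X]mulr1; apply: cvgM => //.
rewrite -[X in _ --> X]addr0 -(mulr0 k%:R); apply: cvgD; first exact: cvg_cst.
by apply: cvgMl_tmp.
Qed.

Lemma csym_rising_cvg (al : nat -> R) (p : nat -> nat -> R) (x : R) k :
  (forall N, 0 < al N) -> (fun N => (al N)^-1) @ \oo --> 0 ->
  (forall N j, 0 <= p N j <= al N) -> (fun N => p N 1%N / al N) @ \oo --> x ->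
  (fun N => k`!%:R * csym (p N) k / rising (al N) k) @ \oo --> x ^+ k.
Proof.
move=> al0 alV pal px.
have -> : (fun N => k`!%:R * csym (p N) k / rising (al N) k) = (fun N =>
    k`!%:R * (csym (p N) k / al N ^+ k) * (rising (al N) k / al N ^+ k)^-1).
  apply/funext => N; field.
  by rewrite expf_neq0 gt_eqF// rising_gt0.
rewrite (_ : x ^+ k = k`!%:R * (x ^+ k / k`!%:R) * 1^-1); last first.
  by rewrite invr1 mulr1 mulrC divfK// pnatr_eq0 -lt0n fact_gt0.
apply: cvgM.
  by apply: cvgMl_tmp; exact: csym_asymptotic.
by apply: cvgV; [exact: oner_neq0|exact: rising_asymptotic].
Qed.

(* Up to the factor [k! / rising (p 0) k], the k-th moment of the sum of the
   first J stick-breaking terms, for p the power sums of the base measure. *)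
Fixpoint stick_csym (p : nat -> R) (J k : nat) : R :=
  if J is J'.+1 then
    (\sum_(i < k.+1) p i * stick_csym p J' (k - i)%N) / (p 0%N + k%:R)
  else (k == 0%N)%:R.

Lemma stick_csym_ge0 (p : nat -> R) J k :
  (forall j, 0 <= p j) -> 0 <= stick_csym p J k.
Proof.
move=> p0; elim: J k => [|J IH] k /=; first by rewrite ler0n.
by rewrite divr_ge0 ?addr_ge0// sumr_ge0// => i _; rewrite mulr_ge0.
Qed.

Lemma stick_csym_le (p : nat -> R) J k : 0 < p 0%N -> (forall j, 0 <= p j) ->
  stick_csym p J k <= csym p k.
Proof.
move=> p00 p0.
have den k' : 0 < p 0%N + k'%:R by rewrite ltr_wpDr.
elim: J k => [|J IH] [|k] /=; rewrite ?csym0 ?csym_ge0//.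
  by rewrite big_ord1 subn0 addr0 /= mulrAC divff ?gt_eqF// mul1r (le_trans (IH _)).
rewrite ler_pdivrMr// mulrC mulrDl csymE ler_sum// => i _.
by rewrite ler_wpM2l.
Qed.

Lemma stick_csym_cvg (p : nat -> R) k : 0 < p 0%N -> (forall j, 0 <= p j) ->
  (fun J => stick_csym p J k) @ \oo --> csym p k.
Proof.
move=> p00 p0.
have den k' : 0 < p 0%N + k'%:R by rewrite ltr_wpDr.
have le_csym J k' : stick_csym p J k' <= csym p k' by exact: stick_csym_le.
have inc J k' : stick_csym p J k' <= stick_csym p J.+1 k'.
  elim: J k' => [|J IH] k'.
    rewrite /=; case: k' => [|k'] /=.
      by rewrite big_ord1 /= mulr1 addr0 divff ?gt_eqF.
    apply: divr_ge0; last exact/ltW.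
    apply: sumr_ge0 => i _.
    by rewrite mulr_ge0// ler0n.
  rewrite [leLHS]/= [leRHS]/= ler_pM2r ?invr_gt0// ler_sum// => i _.
  by rewrite ler_wpM2l//; exact: IH.
have cv k' : cvgn (fun J => stick_csym p J k').
  apply: nondecreasing_is_cvgn; first exact/nondecreasing_seqP.
  by exists (csym p k') => _ [J _ <-].
pose l k' := limn (fun J => stick_csym p J k').
have cl k' : (fun J => stick_csym p J k') @ \oo --> l k' by exact: (cv k').
have lE k' : (p 0%N + k'%:R) * l k' = \sum_(i < k'.+1) p i * l (k' - i)%N.
  have c1 : (fun J => (p 0%N + k'%:R) * stick_csym p J.+1 k') @ \oo -->
      (p 0%N + k'%:R) * l k'.
    by apply: cvgMl_tmp; have := cl k'; rewrite -(cvg_shiftS (fun J => stick_csym p J k')).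
  have c2 : (fun J => (p 0%N + k'%:R) * stick_csym p J.+1 k') @ \oo -->
      \sum_(i < k'.+1) p i * l (k' - i)%N.
    rewrite (_ : (fun J => _) =
      (fun J => \sum_(i < k'.+1) p i * stick_csym p J (k' - i))).
      by apply: (@cvg_sumr R _ _ (fun (i : 'I_k'.+1) J => p i * stick_csym p J (k' - i))
        (fun i => p i * l (k' - i)%N)) => i; apply: cvgMl_tmp; exact: cl.
    by apply/funext => J; rewrite /= mulrC divfK// gt_eqF.
  exact: (cvg_unique _ c1 c2).
have -> : csym p k = l k; last exact: cl.
apply/esym; apply: csym_uniq => [|{}k].
  have e J : stick_csym p J 0 = 1.
    elim: J => [|J IH]//=.
    by rewrite big_ord1 /= IH mulr1 addr0 divff// gt_eqF.
  by rewrite /l; under eq_fun do rewrite e; rewrite lim_cst.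
have := lE k.+1; rewrite big_ord_recl subn0 mulrDl => /addrI ->.
by apply: eq_bigr => i _; rewrite subSS.
Qed.

End csym_limits.

(** * Bounded measurable functions *)

Section bounded_measurable.
Context d (T : measurableType d) (R : realType).
Implicit Types f g : T -> R.

Definition bounded_measurable f :=
  measurable_fun setT f /\ exists M : R, forall x, `|f x| <= M.

Lemma bm_cst (c : R) : bounded_measurable (fun=> c).
Proof. by split; [exact: measurable_cst|exists `|c|]. Qed.

Lemma bmD f g : bounded_measurable f -> bounded_measurable g ->
  bounded_measurable (fun x => f x + g x).
Proof.
move=> [mf [M fM]] [mg [N gN]]; split; first exact: measurable_funD.
exists (M + N) => x.
by rewrite (le_trans (ler_normD _ _))// lerD.
Qed.

Lemma bmM f g : bounded_measurable f -> bounded_measurable g ->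
  bounded_measurable (fun x => f x * g x).
Proof.
move=> [mf [M fM]] [mg [N gN]]; split; first exact: measurable_funM.
exists (M * N) => x.
by rewrite normrM ler_pM.
Qed.

Lemma bmZ (c : R) f : bounded_measurable f -> bounded_measurable (fun x => c * f x).
Proof. by move=> bf; apply: bmM => //; exact: bm_cst. Qed.

Lemma bm_sum I (r : seq I) (F : I -> T -> R) :
  (forall i, bounded_measurable (F i)) ->
  bounded_measurable (fun x => \sum_(i <- r) F i x).
Proof.
move=> bF; elim: r => [|i r IH].
  by under eq_fun do rewrite big_nil; exact: bm_cst.
by under eq_fun do rewrite big_cons; exact: bmD.
Qed.

Lemma bm_prod I (r : seq I) (F : I -> T -> R) :
  (forall i, bounded_measurable (F i)) ->
  bounded_measurable (fun x => \prod_(i <- r) F i x).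
Proof.
move=> bF; elim: r => [|i r IH].
  by under eq_fun do rewrite big_nil; exact: bm_cst.
by under eq_fun do rewrite big_cons; exact: bmM.
Qed.

Lemma bmX f k : bounded_measurable f -> bounded_measurable (fun x => f x ^+ k).
Proof.
move=> bf; elim: k => [|k IH].
  by under eq_fun do rewrite expr0; exact: bm_cst.
by under eq_fun do rewrite exprS; exact: bmM.
Qed.

Lemma bm_indic (A : set T) : measurable A -> bounded_measurable (\1_A : T -> R).
Proof.
move=> mA; split; first exact: measurable_indic.
by exists 1 => x; rewrite indicE; case: (_ \in _); rewrite ?normr1 ?normr0.
Qed.

Definition bounded_linear (L : (T -> R) -> R) :=
  [/\ forall f g, bounded_measurable f -> bounded_measurable g ->
        L (fun x => f x + g x) = L f + L g,
      forall c f, bounded_measurable f -> L (fun x => c * f x) = c * L f &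
      exists2 C : R, 0 <= C & forall f (e : R), bounded_measurable f ->
        (forall x, `|f x| <= e) -> `|L f| <= C * e].

Lemma bounded_linear_sum L I (r : seq I) (c : I -> R) (F : I -> T -> R) :
  bounded_linear L -> (forall i, bounded_measurable (F i)) ->
  L (fun x => \sum_(i <- r) c i * F i x) = \sum_(i <- r) c i * L (F i).
Proof.
move=> [LD LZ _] bF; elim: r => [|i r IH].
  under eq_fun do rewrite big_nil -(mul0r 0).
  by rewrite LZ ?mul0r ?big_nil//; exact: bm_cst.
under eq_fun do rewrite big_cons.
rewrite LD ?LZ ?IH ?big_cons//; first exact: bmZ.
by apply: bm_sum => j; exact: bmZ.
Qed.

Let level f (N i : nat) : set T := [set x | i%:R <= N.+1%:R * f x < i.+1%:R].

Let measurable_level f N i : measurable_fun setT f -> measurable (level f N i).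
Proof.
move=> mf; rewrite [level _ _ _](_ : _ =
    (fun x => N.+1%:R * f x) @^-1` `[i%:R, i.+1%:R[%classic); last first.
  by apply/seteqP; split => x; rewrite /level /= in_itv.
rewrite -[X in measurable X]setTI.
have : measurable_fun setT (fun x => N.+1%:R * f x).
  by apply: measurable_funM => //; exact: measurable_cst.
by apply=> //; exact: measurable_itv.
Qed.

Lemma bounded_linear_eq L1 L2 : bounded_linear L1 -> bounded_linear L2 ->
  (forall A : set T, measurable A -> L1 \1_A = L2 \1_A) ->
  forall f, bounded_measurable f -> L1 f = L2 f.
Proof.
move=> b1 b2 L12.
suff unit f : bounded_measurable f -> (forall x, 0 <= f x <= 1) -> L1 f = L2 f.
  move=> f bf; have [mf [M fM]] := bf.
  have M0 : 0 < `|M| + 1 by rewrite ltr_wpDl.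
  pose c := 2 * (`|M| + 1).
  have c0 : 0 < c by rewrite mulr_gt0.
  pose g x := c^-1 * (f x + (`|M| + 1)).
  have bg : bounded_measurable g by apply: bmZ; apply: bmD => //; exact: bm_cst.
  have fE : f = (fun x => c * g x + (- (`|M| + 1)) * 1).
    by apply/funext => x; rewrite /g mulrA divff ?gt_eqF// mul1r mulr1 addrK.
  have g01 x : 0 <= g x <= 1.
    have := fM x; rewrite ler_norml => /andP[a1 a2].
    have a3 := ler_norm M.
    rewrite /g mulr_ge0 ?invr_ge0 ?(ltW c0)//=; last lra.
    by rewrite mulrC ler_pdivrMr// mul1r /c; lra.
  have [D1 Z1 _] := b1; have [D2 Z2 _] := b2.
  have b_1 : bounded_measurable (fun=> 1 : R) by exact: bm_cst.
  clearbody g; rewrite fE D1 ?D2 ?Z1 ?Z2//; try exact: bmZ.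
  by rewrite !unit// => x; rewrite ler01 lexx.
move=> bf f01; have [mf _] := bf.
have [_ _ [C1 C10 C1P]] := b1; have [_ _ [C2 C20 C2P]] := b2.
have [D1 Z1 _] := b1; have [D2 Z2 _] := b2.
pose s (N : nat) (x : T) := \sum_(i < N.+2) (i%:R / N.+1%:R) * (\1_(level f N i) x : R).
have bi N (i : 'I_N.+2) : bounded_measurable (\1_(level f N i) : T -> R).
  by apply: bm_indic; exact: measurable_level.
have bs N : bounded_measurable (s N) by apply: bm_sum => i; exact: bmZ.
have sE N x : s N x = (Num.truncn (N.+1%:R * f x))%:R / N.+1%:R.
  have /andP[f0 f1] := f01 x.
  have y0 : 0 <= N.+1%:R * f x by rewrite mulr_ge0.
  have tN : (Num.truncn (N.+1%:R * f x) < N.+2)%N.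
    rewrite truncn_lt_nat// (@le_lt_trans _ _ (N.+1%:R * 1)) ?ler_wpM2l//.
    by rewrite mulr1 ltr_nat.
  rewrite /s (bigD1 (Ordinal tN))//= indicE mem_set ?mulr1; last first.
    by rewrite /level /= truncn_itv.
  rewrite big1 ?addr0// => i iN; rewrite indicE memNset ?mulr0//.
  move=> /truncn_def ti; move/eqP: iN; apply; apply/val_inj => /=.
  by rewrite ti.
have sf N x : `|f x - s N x| <= N.+1%:R^-1.
  have /andP[f0 f1] := f01 x.
  have y0 : 0 <= N.+1%:R * f x by rewrite mulr_ge0.
  have /andP[t1 t2] := truncn_itv y0.
  have -> : f x = (N.+1%:R * f x) / N.+1%:R by rewrite mulrAC divff ?mul1r.
  rewrite mulrAC divff// mul1r sE -{1}(mulKf (_ : N.+1%:R != 0 :> R) (f x))//.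
  rewrite [_^-1 * _]mulrC -mulrBl normrM [X in _ * X]ger0_norm ?invr_ge0//.
  rewrite ler_piMl ?invr_ge0// ger0_norm ?subr_ge0//.
  by rewrite lerBlDl natr1 ltW.
have near_f N L C (bL : bounded_linear L)
    (CP : forall f (e : R), bounded_measurable f -> (forall x, `|f x| <= e) -> `|L f| <= C * e) :
    `|L f - L (s N)| <= C * N.+1%:R^-1.
  have [LD LZ _] := bL.
  have -> : L f - L (s N) = L (fun x => f x + (-1) * s N x).
    by rewrite LD ?LZ ?mulN1r//; exact: bmZ.
  by apply: CP => [|x]; [apply: bmD => //; exact: bmZ|rewrite mulN1r].
have L12s N : L1 (s N) = L2 (s N).
  rewrite !bounded_linear_sum//; apply: eq_bigr => i _; congr (_ * _).
  by apply: L12; exact: measurable_level.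
apply/eqP; rewrite -subr_eq0 -normr_le0; apply/ler_addgt0Pl => e e0.
rewrite addr0.
pose N := Num.truncn ((C1 + C2) / e).
have lt : (C1 + C2) * N.+1%:R^-1 <= e.
  by rewrite ler_pdivrMr// mulrC -ler_pdivrMr// ltW// truncnS_gt.
apply: le_trans lt; rewrite mulrDl.
have -> : L1 f - L2 f = (L1 f - L1 (s N)) - (L2 f - L2 (s N)).
  by rewrite L12s; ring.
apply: (le_trans (ler_normB _ _)).
by apply: lerD; apply: near_f.
Qed.

End bounded_measurable.
Arguments bounded_measurable {d T R}.
Arguments bounded_linear {d T R}.

Lemma bm_comp d d' (U : measurableType d') (T : measurableType d) (R : realType)
    (h : U -> T) (f : T -> R) :
  measurable_fun setT h -> bounded_measurable f -> bounded_measurable (f \o h).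
Proof.
move=> mh [mf [M fM]]; split; first exact: measurableT_comp.
by exists M => x; exact: fM.
Qed.

Section expectation.
Context d (Om : measurableType d) (R : realType) (P : probability Om R).
Implicit Types f g : Om -> R.
Local Notation E f := (\int[P]_w f w).

Lemma bm_integrable f : bounded_measurable f -> P.-integrable setT (EFin \o f).
Proof.
move=> [mf [M fM]]; apply: measurable_bounded_integrable => //.
  by rewrite -ge0_fin_numE// fin_num_measure.
exists M; split; first exact: num_real.
by move=> x Mx w _ /=; rewrite (le_trans (fM w))// ltW.
Qed.

Lemma expD f g : bounded_measurable f -> bounded_measurable g ->
  E (fun w => f w + g w) = E f + E g.
Proof. by move=> bf bg; rewrite RintegralD//; exact: bm_integrable. Qed.

Lemma expZ c f : bounded_measurable f -> E (fun w => c * f w) = c * E f.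
Proof. by move=> bf; rewrite RintegralZl//; exact: bm_integrable. Qed.

Lemma exp_cst c : E (fun=> c) = c.
Proof.
by rewrite Rintegral_cst//= (_ : P setT = 1%E) ?mulr1//; exact: probability_setT.
Qed.

Lemma exp_sum I (r : seq I) (F : I -> Om -> R) :
  (forall i, bounded_measurable (F i)) ->
  E (fun w => \sum_(i <- r) F i w) = \sum_(i <- r) E (F i).
Proof.
move=> bF; elim: r => [|i r IH].
  by rewrite big_nil; under eq_Rintegral do rewrite big_nil; rewrite exp_cst.
under eq_Rintegral do rewrite big_cons.
by rewrite expD ?IH ?big_cons//; exact: bm_sum.
Qed.

Lemma exp_normr_le f (M : R) : bounded_measurable f -> (forall w, `|f w| <= M) ->
  `|E f| <= M.
Proof.
move=> bf fM; apply: (le_trans (le_normr_Rintegral _ _)) => //.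
  exact: bm_integrable.
rewrite -[leRHS](exp_cst M); apply: le_Rintegral => //.
  by apply: integrable_norm; exact: bm_integrable.
by apply: bm_integrable; exact: bm_cst.
Qed.

Lemma exp_indic (A : set Om) : measurable A -> E \1_A = fine (P A).
Proof. by move=> mA; rewrite /Rintegral integral_indic// setIT. Qed.

Lemma exp_restrict (H : set Om) f :
  \int[P]_(w in H) f w = E (fun w => \1_H w * f w).
Proof.
rewrite Rintegral_mkcond; apply: eq_Rintegral => w _.
by rewrite /restrict indicE; case: ifP; rewrite ?mul1r ?mul0r.
Qed.

Lemma exp_ae_eq f g : bounded_measurable f -> bounded_measurable g ->
  {ae P, forall w, f w = g w} -> E f = E g.
Proof.
move=> [mf _] [mg _] fg; congr fine; apply: ae_eq_integral => //.
- exact/measurable_EFinP.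
- exact/measurable_EFinP.
- by apply: filterS fg => w /= ->.
Qed.

Lemma exp_cvg (F : nat -> Om -> R) f (M : R) :
  (forall k, measurable_fun setT (F k)) -> measurable_fun setT f ->
  (forall k w, `|F k w| <= M) -> {ae P, forall w, F ^~ w @ \oo --> f w} ->
  (fun k => E (F k)) @ \oo --> E f.
Proof.
move=> mF mf FM Ff.
have bF k : bounded_measurable (F k) by split => //; exists M; exact: FM.
have [|||||fi _ cv] := @dominated_convergence _ _ R P setT measurableT
  (fun k => EFin \o F k) (EFin \o f) (cst M%:E).
- by move=> k; exact/measurable_EFinP.
- exact/measurable_EFinP.
- by apply: filterS Ff => w Fw _; apply/fine_cvgP; split; [exact: nearW|exact: Fw].
- exact: (bm_integrable (bm_cst Om M)).
- by apply: aeW => w k _ /=; rewrite lee_fin FM.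
by apply: fine_cvg; rewrite fineK; [exact: cv|exact: integrable_fin_num].
Qed.

Definition bounded_operator d' (T : measurableType d')
    (Phi : (T -> R) -> (Om -> R)) :=
  [/\ forall h, bounded_measurable h -> bounded_measurable (Phi h),
      forall h k w, bounded_measurable h -> bounded_measurable k ->
        Phi (fun x => h x + k x) w = Phi h w + Phi k w,
      forall c h w, bounded_measurable h -> Phi (fun x => c * h x) w = c * Phi h w &
      forall h (e : R) w, bounded_measurable h -> (forall x, `|h x| <= e) ->
        `|Phi h w| <= e].

Lemma bounded_operator_comp d' (T : measurableType d') (xi : Om -> T) :
  measurable_fun setT xi -> bounded_operator (fun h => h \o xi).
Proof.
move=> mxi; split=> //; first by move=> h bh; exact: bm_comp.
by move=> h e w _ he; exact: he.
Qed.

Lemma bounded_linear_exp d' (T : measurableType d') (Phi : (T -> R) -> (Om -> R))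
    (A : Om -> R) : bounded_operator Phi -> bounded_measurable A ->
  bounded_linear (fun h => E (fun w => A w * Phi h w)).
Proof.
move=> [PhiB PhiD PhiZ PhiC] bA; split.
- move=> h k bh bk; rewrite -expD; [|by apply: bmM => //; exact: PhiB..].
  by apply: eq_Rintegral => w _; rewrite PhiD// mulrDr.
- move=> c h bh; rewrite -expZ; last by apply: bmM => //; exact: PhiB.
  by apply: eq_Rintegral => w _; rewrite PhiZ// mulrCA.
have [mA [M AM]] := bA; exists `|M| => // h e bh he.
apply: exp_normr_le => [|w]; first by apply: bmM => //; exact: PhiB.
rewrite normrM ler_pM// ?PhiC//.
exact: (le_trans (AM w) (ler_norm M)).
Qed.

Lemma bounded_operator_exp d' (T : measurableType d') (xi : Om -> T) :
  measurable_fun setT xi ->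
  bounded_operator (fun (h : T -> R) (_ : Om) => E (h \o xi)).
Proof.
move=> mxi; split.
- by move=> h bh; exact: bm_cst.
- by move=> h k _ bh bk; exact: (expD (bm_comp mxi bh) (bm_comp mxi bk)).
- by move=> c h _ bh; exact: (expZ c (bm_comp mxi bh)).
- move=> h e _ bh he; apply: (exp_normr_le (bm_comp mxi bh)) => w; exact: he.
Qed.

Lemma exp_prod_ext d' (T : measurableType d')
    (Phi Psi : nat -> (T -> R) -> (Om -> R)) s (Y Y' : Om -> R) :
  (forall j, bounded_operator (Phi j)) -> (forall j, bounded_operator (Psi j)) ->
  bounded_measurable Y -> bounded_measurable Y' ->
  (forall B : nat -> set T, (forall j, measurable (B j)) ->
    E (fun w => Y w * \prod_(j < s) Phi j \1_(B j) w) =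
    E (fun w => Y' w * \prod_(j < s) Psi j \1_(B j) w)) ->
  forall h : nat -> T -> R, (forall j, bounded_measurable (h j)) ->
    E (fun w => Y w * \prod_(j < s) Phi j (h j) w) =
    E (fun w => Y' w * \prod_(j < s) Psi j (h j) w).
Proof.
move=> bPhi bPsi; elim: s Y Y' => [|s IH] Y Y' bY bY' eqB h bh.
  have := eqB (fun=> set0) (fun=> measurable0).
  under eq_Rintegral do rewrite big_ord0.
  under [X in _ = X -> _]eq_Rintegral do rewrite big_ord0.
  under [X in _ -> X = _]eq_Rintegral do rewrite big_ord0.
  by under [X in _ -> _ = X]eq_Rintegral do rewrite big_ord0.
have bPh j k : bounded_measurable k -> bounded_measurable (Phi j k).
  by move=> bk; have [+ _ _ _] := bPhi j; exact.
have bPs j k : bounded_measurable k -> bounded_measurable (Psi j k).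
  by move=> bk; have [+ _ _ _] := bPsi j; exact.
pose A w := Y w * \prod_(j < s) Phi j (h j) w.
pose A' w := Y' w * \prod_(j < s) Psi j (h j) w.
have bA : bounded_measurable A.
  by apply: bmM => //; apply: bm_prod => j; exact: bPh.
have bA' : bounded_measurable A'.
  by apply: bmM => //; apply: bm_prod => j; exact: bPs.
have key k : bounded_measurable k -> E (fun w => A w * Phi s k w) =
    E (fun w => A' w * Psi s k w).
  move: k; apply: (@bounded_linear_eq _ _ _ (fun k => E (fun w => A w * Phi s k w))
    (fun k => E (fun w => A' w * Psi s k w))); [exact: bounded_linear_exp..|].
  move=> C mC.
  have bC := bm_indic R mC.
  transitivity (E (fun w => Y w * Phi s \1_C w * \prod_(j < s) Phi j (h j) w)).
    by apply: eq_Rintegral => w _; rewrite /A mulrAC.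
  rewrite (IH _ (fun w => Y' w * Psi s \1_C w))//; first last.
  - move=> B mB; pose B' j := if j == s then C else B j.
    have mB' j : measurable (B' j) by rewrite /B'; case: eqP.
    have := eqB B' mB'.
    under eq_Rintegral do rewrite big_ord_recr /= mulrA mulrAC.
    under [X in _ = X -> _]eq_Rintegral do rewrite big_ord_recr /= mulrA mulrAC.
    have BB j : (j < s)%N -> B' j = B j by move=> js; rewrite /B' ltn_eqF.
    have Bs : B' s = C by rewrite /B' eqxx.
    rewrite Bs; under eq_Rintegral do under eq_bigr do rewrite BB//.
    by under [X in _ = X -> _]eq_Rintegral do under eq_bigr do rewrite BB//.
  - by apply: bmM => //; exact: bPs.
  - by apply: bmM => //; exact: bPh.
  by apply: eq_Rintegral => w _; rewrite /A' mulrAC.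
transitivity (E (fun w => A w * Phi s (h s) w)).
  by apply: eq_Rintegral => w _; rewrite big_ord_recr /= mulrA.
rewrite key//; apply: eq_Rintegral => w _.
by rewrite big_ord_recr /= mulrA.
Qed.

End expectation.

(** * Moments determine joint laws *)

Section moments.
Context {R : realType}.

Lemma bernoulli_ge (y : R) M : -1 <= y -> 1 + M%:R * y <= (1 + y) ^+ M.
Proof.
move=> y1; elim: M => [|M IH]; first by rewrite mul0r addr0 expr0.
have y1' : 0 <= 1 + y by lra.
rewrite exprS; apply: le_trans (ler_wpM2l y1' IH).
have : 0 <= M%:R * (y * y) by rewrite mulr_ge0// -expr2 sqr_ge0.
by rewrite -natr1; lra.
Qed.

Lemma expr1B_le (y : R) M : 0 <= y <= 1 -> (1 - y) ^+ M <= (1 + M%:R * y)^-1.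
Proof.
move=> /andP[y0 y1].
have p : 0 < 1 + M%:R * y by rewrite ltr_wpDr// mulr_ge0.
rewrite -[leRHS]mul1r ler_pdivlMr//.
have q : 0 <= (1 - y) ^+ M by rewrite exprn_ge0// subr_ge0.
apply: (le_trans (ler_wpM2l q (bernoulli_ge M _))); first lra.
rewrite -exprMn exprn_ile1//; nra.
Qed.

Lemma natrX_geometric_cvg (r : R) : 0 <= r < 1 ->
  (fun N => N%:R * r ^+ N.*2) @ \oo --> 0.
Proof.
move=> /andP[r0 r1]; have [->|rn0] := eqVneq r 0.
  apply: cvg_near_cst; apply: nearW => -[|N]; first by rewrite mul0r.
  by rewrite doubleS expr0n mulr0.
have rgt0 : 0 < r by rewrite lt_neqAle eq_sym rn0.
pose de := r^-1 - 1.
have de0 : 0 < de by rewrite subr_gt0 invf_gt1.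
apply: (@squeeze_cvgr _ _ _ _ (fun=> 0) (fun N => (N%:R)^-1 * (de ^+ 2)^-1)).
- near=> N; have N0 : (0 < N)%N by near: N; exists 1%N.
  rewrite mulr_ge0 ?exprn_ge0//=.
  have b : N%:R * de <= r^-1 ^+ N.
    have e : 1 + de = r^-1 by rewrite /de addrC subrK.
    have := @bernoulli_ge de N; rewrite e => b.
    by apply: le_trans (b _); lra.
  have b2 : r ^+ N <= (N%:R * de)^-1.
    rewrite -[r ^+ N]invrK lef_pV2 ?posrE -?exprVn ?exprn_gt0 ?invr_gt0//.
    by rewrite mulr_gt0// ltr0n.
  rewrite -addnn exprD.
  apply: (@le_trans _ _ (N%:R * ((N%:R * de)^-1 * (N%:R * de)^-1))).
    by rewrite ler_wpM2l// ler_pM// exprn_ge0.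
  rewrite (_ : N%:R * _ = N%:R^-1 * (de ^+ 2)^-1)//; field.
  by rewrite gt_eqF//= pnatr_eq0 -lt0n.
- exact: cvg_cst.
rewrite -(mul0r (de ^+ 2)^-1); apply: cvgMr_tmp.
by apply/gtr0_cvgV0; [exists 1%N => // N /= N0; rewrite ltr0n|exact: cvgr_idn].
Unshelve. all: by end_near. Qed.

Definition indic_poly (t : R) N : {poly R} :=
  (1 - 'X^(N.*2)) ^+ Num.truncn (N%:R / t ^+ N.*2).

Lemma indic_polyE t N x : (indic_poly t N).[x] =
  (1 - x ^+ N.*2) ^+ Num.truncn (N%:R / t ^+ N.*2).
Proof. by rewrite /indic_poly !hornerE. Qed.

Lemma indic_poly_itv t N x : 0 <= x <= 1 -> 0 <= (indic_poly t N).[x] <= 1.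
Proof.
move=> /andP[x0 x1]; have y1 : x ^+ N.*2 <= 1 by rewrite exprn_ile1.
have y0 : 0 <= x ^+ N.*2 by rewrite exprn_ge0.
by rewrite indic_polyE exprn_ge0 ?exprn_ile1//; lra.
Qed.

(* With exponent [M ~ N / t ^ (2 N)], the product [M x ^ (2 N)] tends to 0 if
   x < t and to infinity if t <= x. *)
Lemma indic_poly_cvg (t x : R) : 0 < t -> 0 <= x <= 1 ->
  (fun N => (indic_poly t N).[x]) @ \oo --> ((x < t)%R%:R : R).
Proof.
move=> t0 x01; have /andP[x0 x1] := x01.
have tX N : 0 < t ^+ N.*2 by rewrite exprn_gt0.
have M0 N : 0 <= N%:R / t ^+ N.*2 by rewrite divr_ge0// ltW.
have y01 N : 0 <= x ^+ N.*2 <= 1 by rewrite exprn_ge0// exprn_ile1.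
have [xt|tx] := ltP x t.
  apply: (@squeeze_cvgr _ _ _ _ (fun N => 1 - N%:R * (x / t) ^+ N.*2) (fun=> 1)).
  - apply: nearW => N; have /andP[_ ->] := indic_poly_itv t N x01; rewrite andbT.
    rewrite indic_polyE; have /andP[y0 y1] := y01 N.
    apply: le_trans (bernoulli_ge _ _); last by lra.
    rewrite mulrN lerD2l lerN2.
    have /andP[t1 _] := truncn_itv (M0 N).
    apply: (le_trans (ler_wpM2r y0 t1)).
    by rewrite expr_div_n mulrAC mulrA.
  - rewrite -[X in _ --> X]subr0; apply: cvgB; first exact: cvg_cst.
    apply: natrX_geometric_cvg.
    by rewrite divr_ge0// ?ltW// ltr_pdivrMr// mul1r.
  - exact: cvg_cst.
apply: (@squeeze_cvgr _ _ _ _ (fun=> 0) (fun N => (N%:R)^-1)).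
- near=> N; have N0 : (0 < N)%N by near: N; exists 1%N.
  have /andP[-> _] := indic_poly_itv t N x01.
  rewrite indic_polyE; apply: (le_trans (expr1B_le _ (y01 N))).
  have /andP[y0 y1] := y01 N.
  set M := Num.truncn _.
  have tM : N%:R / t ^+ N.*2 < M%:R + 1 by rewrite natr1 truncnS_gt.
  have xtN : t ^+ N.*2 <= x ^+ N.*2 by rewrite lerXn2r// nnegrE ltW// (lt_le_trans t0).
  have NM : N%:R <= 1 + M%:R * x ^+ N.*2.
    have : N%:R <= (M%:R + 1) * x ^+ N.*2.
      rewrite ltr_pdivrMr// in tM; apply: (le_trans (ltW tM)).
      by rewrite ler_wpM2l.
    by rewrite mulrDl mul1r; lra.
  rewrite lef_pV2 ?posrE ?ltr0n//.
  by rewrite (lt_le_trans _ NM)// ltr0n.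
- exact: cvg_cst.
by apply/gtr0_cvgV0; [exists 1%N => // N /= N0; rewrite ltr0n|exact: cvgr_idn].
Unshelve. all: by end_near. Qed.

Lemma eq_poly_nat (m : nat) (u v : nat -> R) :
  (forall t : nat, \sum_(i < m) u i * t%:R ^+ i = \sum_(i < m) v i * t%:R ^+ i) ->
  forall i, (i < m)%N -> u i = v i.
Proof.
move=> uv i im.
pose p : {poly R} := \poly_(i < m) (u i - v i).
have p0 : p = 0.
  apply: (@roots_geq_poly_eq0 _ p [seq t%:R | t <- iota 0 m]).
  - apply/allP => _ /mapP[t _ ->]; rewrite rootE horner_poly.
    under eq_bigr do rewrite mulrBl.
    by rewrite sumrB uv subrr.
  - rewrite map_inj_uniq ?iota_uniq// => a b /eqP.
    by rewrite eqr_nat => /eqP.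
  - by rewrite size_map size_iota size_poly.
have := coef_poly m (fun i => u i - v i) i.
by rewrite -/p p0 coef0 im => /esym/eqP; rewrite subr_eq0 => /eqP.
Qed.

End moments.

Section moments_expectation.
Context d (Om : measurableType d) (R : realType) (P : probability Om R).
Local Notation E f := (\int[P]_w f w).

Lemma exp_horner (A x : Om -> R) (p : {poly R}) :
  bounded_measurable A -> bounded_measurable x ->
  E (fun w => A w * p.[x w]) = \sum_(i < size p) p`_i * E (fun w => A w * x w ^+ i).
Proof.
move=> bA bx.
have bAx i : bounded_measurable (fun w => A w * x w ^+ i).
  by apply: bmM => //; exact: bmX.
under eq_Rintegral do rewrite horner_coef mulr_sumr.
rewrite exp_sum => [|i]; last by apply: bmM => //; apply: bmZ; exact: bmX.
apply: eq_bigr => i _; rewrite -expZ//; apply: eq_Rintegral => w _.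
by rewrite mulrCA.
Qed.

Lemma measurable_lt_set (x : Om -> R) (t : R) : measurable_fun setT x ->
  measurable [set w | x w < t].
Proof.
move=> mx; have := mx measurableT `]-oo, t[%classic (measurable_itv _).
by rewrite setTI; congr measurable; apply/seteqP; split => w /=; rewrite in_itv.
Qed.

Lemma exp_indic_cvg (A x : Om -> R) (t : R) :
  bounded_measurable A -> bounded_measurable x ->
  (forall w, 0 <= x w <= 1) -> 0 < t ->
  (fun N => E (fun w => A w * (indic_poly t N).[x w])) @ \oo -->
  E (fun w => A w * \1_[set w | x w < t] w).
Proof.
move=> bA bx x01 t0; have [mA [M AM]] := bA; have [mx _] := bx.
apply: (@exp_cvg _ _ _ _ _ _ `|M|).
- move=> N; apply: measurable_funM => //.
  have [] // : bounded_measurable (fun w => (indic_poly t N).[x w]).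
  under eq_fun do rewrite horner_coef.
  by apply: bm_sum => i; apply: bmZ; exact: bmX.
- apply: measurable_funM => //; apply: measurable_indic.
  exact: measurable_lt_set.
- move=> N w; have /andP[p0 p1] := indic_poly_itv t N (x01 w).
  rewrite normrM (ger0_norm p0) (le_trans _ (ler_norm _))//.
  apply: (le_trans _ (AM w)); rewrite -[leRHS]mulr1.
  by apply: ler_wpM2l.
- apply: aeW => w; apply: cvgMl_tmp.
  have -> : \1_[set w | x w < t] w = (x w < t)%R%:R :> R.
    by rewrite indicE; congr (nat_of_bool _)%:R; apply/idP/idP => [/set_mem|/mem_set].
  exact: indic_poly_cvg.
Qed.

Lemma moments_indic (A A' x x' : Om -> R) (t : R) :
  bounded_measurable A -> bounded_measurable A' ->
  bounded_measurable x -> bounded_measurable x' ->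
  (forall w, 0 <= x w <= 1) -> (forall w, 0 <= x' w <= 1) ->
  (forall k, E (fun w => A w * x w ^+ k) = E (fun w => A' w * x' w ^+ k)) ->
  E (fun w => A w * \1_[set w | x w < t] w) =
  E (fun w => A' w * \1_[set w | x' w < t] w).
Proof.
move=> bA bA' bx bx' x01 x'01 eqm.
have [t0|t0] := leP t 0.
  have z (y : Om -> R) : (forall w, 0 <= y w <= 1) -> [set w | y w < t] = set0.
    move=> y01; rewrite -subset0 => w /= yt; have /andP[y0 _] := y01 w.
    by have := lt_le_trans yt (le_trans t0 y0); rewrite ltxx.
  rewrite !z//; under eq_Rintegral do rewrite indic0 mulr0.
  by under [RHS]eq_Rintegral do rewrite indic0 mulr0.
have c := exp_indic_cvg bA bx x01 t0; have c' := exp_indic_cvg bA' bx' x'01 t0.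
have EE : (fun N => E (fun w => A w * (indic_poly t N).[x w])) =
          (fun N => E (fun w => A' w * (indic_poly t N).[x' w])).
  by apply/funext => N; rewrite !exp_horner//; apply: eq_bigr => i _; rewrite eqm.
by rewrite EE in c; exact: (cvg_unique _ c c').
Qed.

End moments_expectation.

Section joint_moments.
Context d (Om : measurableType d) (R : realType) (P : probability Om R).
Local Notation E f := (\int[P]_w f w).
Variables (I : Type) (x x' : I -> Om -> R) (Y : Om -> R).
Hypotheses (bY : bounded_measurable Y) (bx : forall i, bounded_measurable (x i))
  (bx' : forall i, bounded_measurable (x' i)).

Let exp_expand (y : I -> Om -> R) (Z : Om -> R) (c : seq I) i t k :
  (forall i, bounded_measurable (y i)) -> bounded_measurable Z ->
  E (fun w => Z w * (\sum_(j <- c ++ nseq t i) y j w) ^+ k) =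
  \sum_(j < k.+1) E (fun w => Z w *
    ((\sum_(i <- c) y i w) ^+ (k - j) * y i w ^+ j *+ 'C(k, j))) * t%:R ^+ j.
Proof.
move=> yB ZB.
have bs : bounded_measurable (fun w => \sum_(i <- c) y i w) by exact: bm_sum.
have bj j : bounded_measurable (fun w => Z w *
    ((\sum_(i <- c) y i w) ^+ (k - j) * y i w ^+ j *+ 'C(k, j))).
  apply: bmM => //; under eq_fun do rewrite -mulr_natl.
  by apply: bmZ; apply: bmM; exact: bmX.
transitivity (E (fun w => \sum_(j < k.+1) t%:R ^+ j * (Z w *
    ((\sum_(i <- c) y i w) ^+ (k - j) * y i w ^+ j *+ 'C(k, j))))).
  apply: eq_Rintegral => w _.
  have -> : \sum_(j <- c ++ nseq t i) y j w = \sum_(j <- c) y j w + t%:R * y i w.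
    by rewrite big_cat big_nseq iter_addr_0 mulr_natl.
  rewrite exprDn mulr_sumr; apply: eq_bigr => j _.
  by rewrite exprMn [LHS]mulrC [in RHS]mulrCA -!mulrnAr -!mulrA; ring.
rewrite exp_sum => [|j]; last exact: bmZ.
by apply: eq_bigr => j _; rewrite expZ// mulrC.
Qed.

(* Polarization: replacing [s = \sum_(j <- c) x j] by [s + t x_i] for all natural
   t, the coefficient of t in the (k+1)-st moment gives the mixed moment
   [s ^+ k * x_i]. *)
Lemma eq_joint_moments :
  (forall c k, E (fun w => Y w * (\sum_(i <- c) x i w) ^+ k) =
               E (fun w => Y w * (\sum_(i <- c) x' i w) ^+ k)) ->
  forall l, E (fun w => Y w * \prod_(i <- l) x i w) =
            E (fun w => Y w * \prod_(i <- l) x' i w).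
Proof.
move=> eqs l.
suff gen c k : E (fun w => (Y w * \prod_(i <- l) x i w) * (\sum_(i <- c) x i w) ^+ k) =
    E (fun w => (Y w * \prod_(i <- l) x' i w) * (\sum_(i <- c) x' i w) ^+ k).
  have := gen [::] 0%N; under eq_Rintegral do rewrite expr0 mulr1.
  by under [X in _ = X -> _]eq_Rintegral do rewrite expr0 mulr1.
elim: l c k => [|i l IH] c k.
  under eq_Rintegral do rewrite big_nil mulr1.
  by under [RHS]eq_Rintegral do rewrite big_nil mulr1.
have bZ : bounded_measurable (fun w => Y w * \prod_(i <- l) x i w).
  by apply: bmM => //; exact: bm_prod.
have bZ' : bounded_measurable (fun w => Y w * \prod_(i <- l) x' i w).
  by apply: bmM => //; exact: bm_prod.
pose u j := E (fun w => (Y w * \prod_(i <- l) x i w) *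
    ((\sum_(i <- c) x i w) ^+ (k.+1 - j) * x i w ^+ j *+ 'C(k.+1, j))).
pose v j := E (fun w => (Y w * \prod_(i <- l) x' i w) *
    ((\sum_(i <- c) x' i w) ^+ (k.+1 - j) * x' i w ^+ j *+ 'C(k.+1, j))).
have uv : u 1%N = v 1%N.
  apply: (@eq_poly_nat _ k.+2) => // t.
  have := IH (c ++ nseq t i) k.+1.
  by rewrite (exp_expand _ _ _ _ bx bZ) (exp_expand _ _ _ _ bx' bZ').
have bm (y : I -> Om -> R) : (forall i, bounded_measurable (y i)) ->
    bounded_measurable (fun w => (Y w * \prod_(i <- i :: l) y i w) *
      (\sum_(i <- c) y i w) ^+ k).
  move=> yB; apply: bmM; first by apply: bmM => //; exact: bm_prod.
  by apply: bmX; exact: bm_sum.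
apply: (@mulfI _ k.+1%:R); first by rewrite pnatr_eq0.
rewrite -!expZ; [|exact: bm..].
transitivity (u 1%N); last rewrite uv.
  apply: eq_Rintegral => w _.
  by rewrite subn1 /= bin1 big_cons expr1 -[in RHS]mulr_natl; ring.
apply: eq_Rintegral => w _.
by rewrite subn1 /= bin1 big_cons expr1 -[in LHS]mulr_natl; ring.
Qed.

Hypotheses (x01 : forall i w, 0 <= x i w <= 1) (x01' : forall i w, 0 <= x' i w <= 1).

Lemma eq_joint_cdf :
  (forall l, E (fun w => Y w * \prod_(i <- l) x i w) =
             E (fun w => Y w * \prod_(i <- l) x' i w)) ->
  forall s : seq (I * R),
    E (fun w => Y w * \prod_(p <- s) \1_[set w | x p.1 w < p.2] w) =
    E (fun w => Y w * \prod_(p <- s) \1_[set w | x' p.1 w < p.2] w).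
Proof.
move=> eqm s.
suff gen l : E (fun w => Y w * \prod_(p <- s) \1_[set w | x p.1 w < p.2] w *
      \prod_(i <- l) x i w) =
    E (fun w => Y w * \prod_(p <- s) \1_[set w | x' p.1 w < p.2] w *
      \prod_(i <- l) x' i w).
  have := gen [::]; under eq_Rintegral do rewrite big_nil mulr1.
  by under [X in _ = X -> _]eq_Rintegral do rewrite big_nil mulr1.
elim: s l => [|p s IH] l.
  under eq_Rintegral do rewrite big_nil mulr1.
  by under [RHS]eq_Rintegral do rewrite big_nil mulr1.
have bA (y : I -> Om -> R) : (forall i, bounded_measurable (y i)) ->
    bounded_measurable (fun w => Y w * \prod_(p <- s) \1_[set w | y p.1 w < p.2] w *
      \prod_(i <- l) y i w).
  move=> yB; apply: bmM; last exact: bm_prod.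
  apply: bmM => //; apply: bm_prod => q; apply: bm_indic.
  by apply: measurable_lt_set; have [] := yB q.1.
have k := @moments_indic _ _ _ P _ _ _ _ p.2 (bA _ bx) (bA _ bx') (bx p.1)
  (bx' p.1) (x01 p.1) (x01' p.1).
transitivity (E (fun w => Y w * \prod_(p <- s) \1_[set w | x p.1 w < p.2] w *
      \prod_(i <- l) x i w * \1_[set w | x p.1 w < p.2] w)).
  by apply: eq_Rintegral => w _; rewrite big_cons; ring.
rewrite k => [|n].
  by apply: eq_Rintegral => w _; rewrite big_cons; ring.
have := IH (l ++ nseq n p.1).
have e (y : I -> Om -> R) w :
    \prod_(i <- l ++ nseq n p.1) y i w = \prod_(i <- l) y i w * y p.1 w ^+ n.
  by rewrite big_cat big_nseq /= iter_mulr_1.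
under eq_Rintegral do rewrite e mulrA.
by under [X in _ = X -> _]eq_Rintegral do rewrite e mulrA.
Qed.

End joint_moments.

Lemma dynkin_eq_prob d d' (Om : measurableType d) (T : measurableType d')
    (R : realType) (P : probability Om R) (m m' : Om -> T) (H : set Om)
    (G : set (set T)) :
  measurable_fun setT m -> measurable_fun setT m' -> measurable H ->
  setI_closed G -> G `<=` measurable ->
  (forall C, G C -> P (m @^-1` C `&` H) = P (m' @^-1` C `&` H)) ->
  forall C, <<s G >> C -> P (m @^-1` C `&` H) = P (m' @^-1` C `&` H).
Proof.
move=> mm mm' mH GI Gm GP C; rewrite -(setI_closed_g_dynkin_g_sigma_algebra GI).
have pre (n : Om -> T) D : measurable_fun setT n -> measurable D ->
    measurable (n @^-1` D `&` H).
  by move=> mn mD; apply: measurableI => //; rewrite -[X in measurable X]setTI; exact: mn.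
suff : <<d G >> `<=` [set D | measurable D /\ P (m @^-1` D `&` H) = P (m' @^-1` D `&` H)].
  by move=> /[apply] -[].
apply: smallest_sub; last by move=> D GD; split; [exact: Gm|exact: GP].
split.
- by split; [exact: measurableT|rewrite !preimage_setT].
- move=> D [mD PD]; split; first exact: measurableC.
  have e (n : Om -> T) : n @^-1` (~` D) `&` H = H `\` (n @^-1` D `&` H).
    by apply/seteqP; split => w /= => [[a b]|[a b]]; tauto.
  have fH : (P H < +oo)%E by rewrite -ge0_fin_numE// fin_num_measure.
  rewrite !e measureD ?measureD//; try exact: pre.
  have e' (n : Om -> T) : H `&` (n @^-1` D `&` H) = n @^-1` D `&` H.
    by rewrite setICA setIid.
  by rewrite !e'; congr (_ - _)%E; exact: PD.
- move=> F tF FP; split; first by apply: bigcupT_measurable => i; have [] := FP i.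
  have e (n : Om -> T) : n @^-1` (\bigcup_i F i) `&` H =
      \bigcup_i (n @^-1` F i `&` H) by rewrite preimage_bigcup setI_bigcupl.
  have tr (n : Om -> T) : trivIset setT (fun i => n @^-1` F i `&` H).
    apply/trivIsetP => i j _ _ ij; move/trivIsetP : tF => /(_ i j I I ij) Fij.
    by apply/seteqP; split => w //= -[[a _] [b _]]; have : (F i `&` F j) (n w) by []; rewrite Fij.
  rewrite !e !measure_bigcup//; try by move=> i _; apply: pre => //; have [] := FP i.
  by apply: eq_eseriesr => i _; have [] := FP i.
Qed.

(** * The Polya urn martingale *)

Section csym_bound.
Context {R : realFieldType}.

Lemma le_csym (p q : nat -> R) k : (forall j, 0 <= p j <= q j) -> csym p k <= csym q k.
Proof.
move=> pq; have p0 j : 0 <= p j by have /andP[] := pq j.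
elim/ltn_ind: k => -[|k] IH; first by rewrite !csym0.
rewrite -(@ler_pM2l _ k.+1%:R) ?ltr0n// !csymS ler_sum// => j _.
have /andP[_ pqj] := pq j.+1.
by rewrite ler_pM// ?csym_ge0// IH// ltnS leq_subr.
Qed.

Lemma csym_cst (a : R) k : csym (fun=> a) k = rising a k / k`!%:R.
Proof.
apply/esym; move: k; apply: csym_uniq; first by rewrite rising0 fact0 divr1.
have rS k : k.+1%:R * (rising a k.+1 / k.+1`!%:R) = (a + k%:R) * (rising a k / k`!%:R).
  by rewrite risingS factS natrM; field; rewrite nat1r !pnatr_eq0 /= -lt0n fact_gt0.
have rev k : \sum_(j < k.+1) a * (rising a (k - j) / (k - j)`!%:R) =
    \sum_(j < k.+1) a * (rising a j / j`!%:R).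
  rewrite [RHS](reindex_inj rev_ord_inj) /=; apply: eq_bigr => j _.
  by rewrite subSS.
elim=> [|k IH]; first by rewrite rS big_ord1 subnn addr0.
rewrite rev big_ord_recr /= -rev -IH rS.
by rewrite mulrDl addrC.
Qed.

Lemma csym_rising_itv (p : nat -> R) k : 0 < p 0%N -> (forall j, 0 <= p j <= p 0%N) ->
  0 <= k`!%:R * csym p k / rising (p 0%N) k <= 1.
Proof.
move=> p0 pp; have r0 := rising_gt0 k p0.
have f0 : (0 : R) < k`!%:R by rewrite ltr0n fact_gt0.
have ps j : 0 <= p j by have /andP[] := pp j.
apply/andP; split.
  by apply: divr_ge0; [apply: mulr_ge0 => //; exact: csym_ge0|exact: ltW].
rewrite ler_pdivrMr// mul1r mulrC -ler_pdivlMr//.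
by rewrite -csym_cst; exact: le_csym.
Qed.

End csym_bound.

Section urn.
Context d (Om : measurableType d) (R : realType) (P : probability Om R).
Local Notation E f := (\int[P]_w f w).

(* [adapted N] stands for the bounded F_N-measurable functions. *)
Variables (adapted : nat -> (Om -> R) -> Prop) (Y : nat -> Om -> R)
  (c : nat -> R) (n : nat) (A : Om -> R).
Hypotheses
  (adapted_bm : forall N f, adapted N f -> bounded_measurable f)
  (adapted_cst : forall N b, adapted N (fun=> b))
  (adaptedD : forall N f g, adapted N f -> adapted N g -> adapted N (fun w => f w + g w))
  (adaptedM : forall N f g, adapted N f -> adapted N g -> adapted N (fun w => f w * g w))
  (adaptedY : forall N i, (i < N)%N -> adapted N (Y i))
  (adaptedA : forall N, (n <= N)%N -> adapted N A).
Hypotheses (Y01 : forall i w, 0 <= Y i w <= 1)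
  (c0 : 0 < c 0%N) (cj : forall j, 0 <= c j <= c 0%N).

Definition urn_power_sum N w j : R := c j + \sum_(i < N) Y i w ^+ j.
Local Notation p := urn_power_sum.
Local Notation al N := (c 0%N + N%:R).

Hypothesis urn : forall N j f, (n <= N)%N -> adapted N f ->
  al N * E (fun w => f w * Y N w ^+ j) = E (fun w => f w * p N w j).

Lemma adapted_sum N I (r : seq I) (F : I -> Om -> R) :
  (forall i, adapted N (F i)) -> adapted N (fun w => \sum_(i <- r) F i w).
Proof.
move=> aF; elim: r => [|i r IH].
  by under eq_fun do rewrite big_nil; exact: adapted_cst.
by under eq_fun do rewrite big_cons; exact: adaptedD.
Qed.

Lemma adapted_power_sum N j : adapted N (fun w => p N w j).
Proof.
apply: adaptedD; first exact: adapted_cst.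
apply: adapted_sum => i; elim: j => [|j IH].
  by under eq_fun do rewrite expr0; exact: adapted_cst.
under eq_fun do rewrite exprS; apply: adaptedM => //.
exact: adaptedY.
Qed.

Lemma adapted_csym N k : adapted N (fun w => csym (p N w) k).
Proof.
elim/ltn_ind: k => -[|k] IH; first exact: adapted_cst.
have -> : (fun w => csym (p N w) k.+1) = (fun w => k.+1%:R^-1 *
    \sum_(j < k.+1) p N w j.+1 * csym (p N w) (k - j)).
  by apply/funext => w; rewrite -csymS mulKf// pnatr_eq0.
apply: adaptedM; first exact: adapted_cst.
apply: adapted_sum => j; apply: adaptedM; first exact: adapted_power_sum.
by apply: IH; rewrite ltnS leq_subr.
Qed.

Lemma power_sum0 N w : p N w 0%N = al N.
Proof.
rewrite /p; under eq_bigr do rewrite expr0.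
by rewrite sumr_const card_ord.
Qed.

Lemma power_sum_itv N w j : 0 <= p N w j <= p N w 0%N.
Proof.
have /andP[a b] := cj j; rewrite /p addr_ge0//=; last first.
  by apply: sumr_ge0 => i _; apply: exprn_ge0; have /andP[] := Y01 i w.
rewrite lerD// ler_sum// => i _; have /andP[y0 y1] := Y01 i w.
by rewrite expr0 exprn_ile1.
Qed.

Let al0 N : 0 < al N. Proof. by rewrite ltr_wpDr. Qed.

Lemma urn_step N k : (n <= N)%N ->
  al N * E (fun w => A w * csym (p N.+1 w) k) =
  (al N + k%:R) * E (fun w => A w * csym (p N w) k).
Proof.
move=> nN; have aA := adaptedA nN.
have bA := adapted_bm aA.
have bc i := adapted_bm (adapted_csym N i).
have bp i := adapted_bm (adapted_power_sum N i).
have bY : bounded_measurable (Y N) by exact: (adapted_bm (adaptedY (ltnSn N))).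
have pS w : p N.+1 w = (fun j => p N w j + Y N w ^+ j).
  by apply/funext => j; rewrite /p big_ord_recr /= addrA.
transitivity (al N * E (fun w => \sum_(i < k.+1)
    A w * csym (p N w) (k - i) * Y N w ^+ i)).
  congr (_ * _); apply: eq_Rintegral => w _.
  rewrite pS csym_add mulr_sumr; apply: eq_bigr => i _.
  by rewrite mulrCA -mulrA mulrC -mulrA.
rewrite exp_sum => [|i]; last by apply: bmM; [exact: bmM|exact: bmX].
rewrite mulr_sumr.
transitivity (\sum_(i < k.+1) E (fun w => A w * csym (p N w) (k - i) * p N w i)).
  by apply: eq_bigr => i _; rewrite urn//; apply: adaptedM => //; exact: adapted_csym.
rewrite -exp_sum => [|i]; last by apply: bmM => //; exact: bmM.
rewrite -expZ; last exact: bmM.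
apply: eq_Rintegral => w _; rewrite mulrCA mulrDl -{1}(power_sum0 N w) csymE mulr_sumr.
by apply: eq_bigr => i _; ring.
Qed.

Lemma urn_martingale N k : (n <= N)%N ->
  E (fun w => A w * (k`!%:R * csym (p N w) k / rising (al N) k)) =
  E (fun w => A w * (k`!%:R * csym (p n w) k / rising (al n) k)).
Proof.
have bc M i := adapted_bm (adapted_csym M i).
have eZ M : (n <= M)%N ->
    E (fun w => A w * (k`!%:R * csym (p M w) k / rising (al M) k)) =
    k`!%:R / rising (al M) k * E (fun w => A w * csym (p M w) k).
  move=> nM; rewrite -expZ; last by apply: bmM => //; exact: (adapted_bm (adaptedA nM)).
  by apply: eq_Rintegral => w _; ring.
move=> /subnK <-; elim: (N - n)%N => // m IH.
rewrite addSn -IH !eZ ?leq_addl//; last by rewrite -addSn leq_addl.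
set M := (m + n)%N; have nM : (n <= M)%N by rewrite leq_addl.
have st := urn_step k nM.
apply: (@mulfI _ (al M)); first by rewrite gt_eqF.
rewrite mulrCA st -natr1 addrA.
have := risingSl (al M) k; rewrite risingS => e.
have r0 := rising_gt0 k (al0 M).
have r1 : 0 < rising (al M + 1) k by rewrite rising_gt0// addr_gt0.
have ak : 0 < al M + k%:R by rewrite ltr_wpDr.
have -> : rising (al M + 1) k = rising (al M) k * (al M + k%:R) / al M.
  by rewrite e mulrAC divff ?mul1r// gt_eqF.
by field; rewrite !gt_eqF// al0.
Qed.

Lemma urn_limit_moment (x : Om -> R) k : measurable_fun setT x ->
  {ae P, forall w, (fun N => p N w 1%N / al N) @ \oo --> x w} ->
  E (fun w => A w * x w ^+ k) =
  E (fun w => A w * (k`!%:R * csym (p n w) k / rising (al n) k)).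
Proof.
move=> mx px; have [mA [M AM]] := adapted_bm (adaptedA (leqnn n)).
set mk := fun N w => k`!%:R * csym (p N w) k / rising (al N) k.
have cv : (fun N => E (fun w => A w * mk N w)) @ \oo --> E (fun w => A w * x w ^+ k).
  apply: (@exp_cvg _ _ _ _ _ _ `|M|).
  - move=> N; apply: measurable_funM => //.
    have [] // : bounded_measurable (mk N).
    rewrite /mk; under eq_fun do rewrite mulrC mulrA.
    by apply: bmZ; exact: (adapted_bm (adapted_csym N k)).
  - by apply: measurable_funM => //; exact: measurable_funX.
  - move=> N w; have := @csym_rising_itv R (p N w) k.
    rewrite power_sum0 => /(_ (al0 N)) h.
    have /andP[m0 m1] : 0 <= mk N w <= 1.
      by apply: h => j; rewrite -(power_sum0 N w); exact: power_sum_itv.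
    rewrite normrM (ger0_norm m0) (le_trans _ (ler_norm _))//.
    by apply: (le_trans _ (AM w)); rewrite -[leRHS]mulr1; apply: ler_wpM2l.
  - apply: filterS px => w pw; apply: cvgMl_tmp; apply: csym_rising_cvg => //.
      apply/gtr0_cvgV0; first exact: nearW.
      apply/cvgryPge => B; have /cvgryPge /(_ B) := @cvgr_idn R.
      by apply: filterS => N BN; rewrite ler_wpDl// ltW.
    by move=> N j; rewrite -(power_sum0 N w); exact: power_sum_itv.
have cv' : (fun N => E (fun w => A w * mk N w)) @ \oo --> E (fun w => A w * mk n w).
  apply: cvg_near_cst; exists n => // N /= nN.
  exact: urn_martingale.
exact: (cvg_unique _ cv cv').
Qed.

End urn.

(** * Moments of stick-breaking sums *)

(* [beta_moment al a b] is the expectation of [W ^+ a * (1 - W) ^+ b] for W with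
   the beta(1, al) distribution. *)
Definition beta_moment (R : fieldType) (al : R) (a b : nat) : R :=
  al * a`!%:R * rising al b / rising al (a + b).+1.

Section stick_moments.
Context d (Om : measurableType d) (R : realType) (P : probability Om R).
Local Notation E f := (\int[P]_w f w).
Variables (W U : nat -> Om -> R) (al : R) (p : Om -> nat -> R) (A : Om -> R).

Fixpoint stick_sum (s J : nat) (w : Om) : R :=
  if J is J'.+1 then W s w * U s w + (1 - W s w) * stick_sum s.+1 J' w else 0.

Lemma stick_sumE s J w : stick_sum s J w =
  \sum_(j < J) stick_breaking (fun i => W (s + i)%N w) j * U (s + j)%N w.
Proof.
elim: J s => [|J IH] s /=; first by rewrite big_ord0.
rewrite big_ord_recl /stick_breaking big_ord0 mulr1 !addn0; congr (_ + _).
rewrite IH mulr_sumr; apply: eq_bigr => j _.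
rewrite /stick_breaking big_ord_recl /= !addn0 /bump /= !add1n addnS addSn.
under [in RHS]eq_bigr do rewrite /bump /= add1n addnS -addSn.
by ring.
Qed.

Hypotheses (W01 : forall i w, 0 <= W i w <= 1) (U01 : forall i w, 0 <= U i w <= 1).

Lemma stick_sum_itv s J w : 0 <= stick_sum s J w <= 1.
Proof.
elim: J s => [|J IH] s /=; first by rewrite lexx ler01.
have /andP[w0 w1] := W01 s w; have /andP[u0 u1] := U01 s w.
by have /andP[d0 d1] := IH s.+1; apply/andP; split; nra.
Qed.

Hypotheses (mW : forall i, measurable_fun setT (W i))
  (mU : forall i, measurable_fun setT (U i)).

Let bW i : bounded_measurable (W i).
Proof. by split=> //; exists 1 => w; have /andP[a b] := W01 i w; rewrite ger0_norm. Qed.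

Let bU i : bounded_measurable (U i).
Proof. by split=> //; exists 1 => w; have /andP[a b] := U01 i w; rewrite ger0_norm. Qed.

Let b1W i : bounded_measurable (fun w => 1 - W i w).
Proof.
under eq_fun do rewrite -mulN1r.
by apply: bmD; [exact: bm_cst|exact: bmZ].
Qed.

Lemma bm_stick_sum s J : bounded_measurable (stick_sum s J).
Proof.
elim: J s => [|J IH] s /=; first exact: bm_cst.
by apply: bmD; apply: bmM.
Qed.

Hypotheses (al0 : 0 < al) (p0 : forall w, p w 0%N = al)
  (pp : forall w j, 0 <= p w j <= al)
  (mp : forall j, measurable_fun setT (p ^~ j)) (bA : bounded_measurable A).

Let bp j : bounded_measurable (p ^~ j).
Proof. by split=> //; exists al => w; have /andP[a b] := pp w j; rewrite ger0_norm. Qed.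

Let pref s (a b : nat -> nat) w :=
  \prod_(j < s) (W j w ^+ a j * (1 - W j w) ^+ b j * U j w ^+ a j).
Let cpref s (a b : nat -> nat) w :=
  \prod_(j < s) (beta_moment al (a j) (b j) * (p w (a j) / al)).

Hypothesis prefE : forall s a b,
  E (fun w => A w * pref s a b w) = E (fun w => A w * cpref s a b w).

Let bpref s a b : bounded_measurable (pref s a b).
Proof.
rewrite /pref; apply: bm_prod => j.
by apply: bmM; [apply: bmM|]; exact: bmX.
Qed.

Let bcpref s a b : bounded_measurable (cpref s a b).
Proof.
rewrite /cpref; apply: bm_prod => j.
by apply: bmZ; apply: bmM => //; exact: bm_cst.
Qed.

Lemma bm_stick_csym J k : bounded_measurable (fun w => stick_csym (p w) J k).
Proof.
elim: J k => [|J IH] k /=; first exact: bm_cst.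
under eq_fun do rewrite p0.
apply: bmM; last exact: bm_cst.
by apply: bm_sum => i; exact: bmM.
Qed.

Let stick_sum_moment_gen s a b J k :
  E (fun w => A w * pref s a b w * stick_sum s J w ^+ k) =
  E (fun w => A w * cpref s a b w * (k`!%:R / rising al k * stick_csym (p w) J k)).
Proof.
elim: J s a b k => [|J IH] s a b k.
  rewrite /=; case: k => [|k].
    under eq_Rintegral do rewrite expr0 mulr1.
    under [RHS]eq_Rintegral do rewrite fact0 rising0 divr1 !mulr1.
    exact: prefE.
  apply: eq_Rintegral => w _; rewrite expr0n /=.
  by rewrite !mulr0.
pose upd (f : nat -> nat) i j := if j == s then i else f j.
have updE (f : nat -> nat) i (j : 'I_s) : upd f i j = f j by rewrite /upd ltn_eqF.
have upds (f : nat -> nat) i : upd f i s = i by rewrite /upd eqxx.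
have prefS i k' w : pref s.+1 (upd a i) (upd b k') w =
    pref s a b w * (W s w ^+ i * (1 - W s w) ^+ k' * U s w ^+ i).
  rewrite /pref big_ord_recr /= !upds; congr (_ * _).
  by apply: eq_bigr => j _; rewrite !updE.
have cprefS i k' w : cpref s.+1 (upd a i) (upd b k') w =
    cpref s a b w * (beta_moment al i k' * (p w i / al)).
  rewrite /cpref big_ord_recr /= !upds; congr (_ * _).
  by apply: eq_bigr => j _; rewrite !updE.
transitivity (E (fun w => \sum_(i < k.+1) 'C(k, i)%:R *
    (A w * pref s.+1 (upd a i) (upd b (k - i)%N) w * stick_sum s.+1 J w ^+ (k - i)))).
  apply: eq_Rintegral => w _.
  rewrite /= addrC exprDn mulr_sumr; apply: eq_bigr => i _.
  by rewrite prefS -mulr_natl !exprMn; ring.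
rewrite exp_sum => [|i]; last first.
  by apply: bmZ; apply: bmM; [exact: bmM|apply: bmX; exact: bm_stick_sum].
transitivity (\sum_(i < k.+1) E (fun w => 'C(k, i)%:R *
    (A w * cpref s.+1 (upd a i) (upd b (k - i)%N) w *
     ((k - i)`!%:R / rising al (k - i) * stick_csym (p w) J (k - i))))).
  apply: eq_bigr => i _; rewrite !expZ ?IH//.
    by apply: bmM; [exact: bmM|apply: bmZ; exact: bm_stick_csym].
  by apply: bmM; [exact: bmM|apply: bmX; exact: bm_stick_sum].
rewrite -exp_sum => [|i]; last first.
  by apply: bmZ; apply: bmM; [exact: bmM|apply: bmZ; exact: bm_stick_csym].
apply: eq_Rintegral => w _; rewrite /= p0.
rewrite mulr_suml !mulr_sumr; apply: eq_bigr => i _.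
have ik : (i <= k)%N by rewrite -ltnS.
rewrite cprefS /beta_moment subnKC// risingS -(bin_fact ik) !natrM.
have r0 := gt_eqF (rising_gt0 k al0); have r1 := gt_eqF (rising_gt0 (k - i) al0).
have r2 : al + k%:R != 0 by rewrite gt_eqF// ltr_wpDr.
by field; rewrite r0 r1 r2 gt_eqF.
Qed.

Lemma stick_sum_moment J k :
  E (fun w => A w * stick_sum 0 J w ^+ k) =
  E (fun w => A w * (k`!%:R / rising al k * stick_csym (p w) J k)).
Proof.
have := @stick_sum_moment_gen 0 (fun=> 0%N) (fun=> 0%N) J k.
rewrite /pref /cpref; under eq_Rintegral do rewrite big_ord0 mulr1.
by under [X in _ = X -> _]eq_Rintegral do rewrite big_ord0 mulr1.
Qed.

Lemma stick_limit_moment (D : Om -> R) k : measurable_fun setT D ->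
  {ae P, forall w, (fun J => stick_sum 0 J w) @ \oo --> D w} ->
  E (fun w => A w * D w ^+ k) =
  E (fun w => A w * (k`!%:R * csym (p w) k / rising al k)).
Proof.
move=> mD DJ; have [mA [M AM]] := bA.
have cv : (fun J => E (fun w => A w * stick_sum 0 J w ^+ k)) @ \oo -->
    E (fun w => A w * D w ^+ k).
  apply: (@exp_cvg _ _ _ _ _ _ `|M|).
  - by move=> J; apply: measurable_funM => //; apply: measurable_funX;
      have [] := bm_stick_sum 0 J.
  - by apply: measurable_funM => //; exact: measurable_funX.
  - move=> J w; have /andP[s0 s1] := stick_sum_itv 0 J w.
    rewrite normrM (le_trans _ (ler_norm _))// (le_trans _ (AM w))//.
    by rewrite -[leRHS]mulr1 ler_wpM2l// ger0_norm ?exprn_ge0// exprn_ile1.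
  - apply: filterS DJ => w Dw; apply: cvgMl_tmp.
    exact: (cvg_comp (fun J => stick_sum 0 J w) (fun x : R => x ^+ k) Dw
      (@exprn_continuous R k (D w))).
have r0 := rising_gt0 k al0.
have f0 : (0 : R) < k`!%:R by rewrite ltr0n fact_gt0.
have ps w j : 0 <= p w j by have /andP[] := pp w j.
have cw w : (fun J => stick_csym (p w) J k) @ \oo --> csym (p w) k.
  by apply: stick_csym_cvg => //; rewrite p0.
have cv' : (fun J => E (fun w => A w * (k`!%:R / rising al k * stick_csym (p w) J k)))
    @ \oo --> E (fun w => A w * (k`!%:R * csym (p w) k / rising al k)).
  apply: (@exp_cvg _ _ _ _ _ _ `|M|).
  - move=> J; apply: measurable_funM => //.
    by have [] : bounded_measurable (fun w => k`!%:R / rising al k * stick_csym (p w) J k)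
      by apply: bmZ; exact: bm_stick_csym.
  - apply: measurable_funM => //.
    apply: (@measurable_fun_cvg _ _ _ _
      (fun J w => k`!%:R / rising al k * stick_csym (p w) J k)) => [J|w _].
      have [] // : bounded_measurable (fun w => k`!%:R / rising al k * stick_csym (p w) J k).
      by apply: bmZ; exact: bm_stick_csym.
    by rewrite mulrAC; apply: cvgMl_tmp.
  - move=> J w.
    have s0 : 0 <= stick_csym (p w) J k by exact: stick_csym_ge0.
    have sl : stick_csym (p w) J k <= csym (p w) k.
      by apply: stick_csym_le => //; rewrite p0.
    have /andP[_ c1] : 0 <= k`!%:R * csym (p w) k / rising (p w 0%N) k <= 1.
      by apply: csym_rising_itv => [|j]; rewrite p0.
    have c0 : 0 <= k`!%:R / rising al k by rewrite divr_ge0 ?ltW.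
    rewrite normrM (le_trans _ (ler_norm _))// (le_trans _ (AM w))//.
    rewrite -[leRHS]mulr1 ler_wpM2l// ger0_norm; last exact: mulr_ge0.
    apply: (le_trans (ler_wpM2l c0 sl)); apply: le_trans c1.
    by rewrite p0 mulrAC.
  - by apply: aeW => w; apply: cvgMl_tmp; rewrite mulrAC; apply: cvgMl_tmp.
have EE : (fun J => E (fun w => A w * stick_sum 0 J w ^+ k)) =
   (fun J => E (fun w => A w * (k`!%:R / rising al k * stick_csym (p w) J k))).
  by apply/funext => J; exact: stick_sum_moment.
by rewrite EE in cv; exact: (cvg_unique _ cv cv').
Qed.

End stick_moments.

Section beta_moments.
Context {R : realType}.
Local Notation leb := (@lebesgue_measure R).

Lemma powR_LRcontinuous (c : R) : 0 < c ->
  derivable_oo_LRcontinuous (fun x : R => x `^ c) 0 1.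
Proof.
move=> c0; split.
- move=> x; rewrite in_itv /= => /andP[x0 _].
  by apply: derivable_powR; rewrite in_itv /= andbT.
- by rewrite powR0 ?gt_eqF//; exact: powR_cvg0.
- apply: cvg_at_left_filter.
  suff : {for 1, continuous (fun x : R => x `^ c)} by [].
  apply/differentiable_continuous/derivable1_diffP.
  by apply: derivable_powR; rewrite in_itv /= andbT.
Qed.

Lemma Rintegral_powR (c : R) : 0 < c ->
  \int[leb]_(x in `[0, 1]) (x `^ c) = (c + 1)^-1.
Proof.
move=> c0; have c1 : 0 < c + 1 by rewrite addr_gt0.
rewrite /Rintegral.
rewrite (@continuous_FTC2 _ _ (fun x => (c + 1)^-1 * x `^ (c + 1)))//=.
- by rewrite powR0 ?gt_eqF// mulr0 subr0 powR1 mulr1.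
- exact: (derivable_oo_LRcontinuous_within (powR_LRcontinuous c0)).
- have [d1 d2 d3] := powR_LRcontinuous c1; split.
  + by move=> x x01; apply: derivableM; [exact: derivable_cst|exact: d1].
  + exact: cvgMl_tmp.
  + exact: cvgMl_tmp.
- move=> x; rewrite in_itv /= => /andP[x0 _].
  rewrite derive1E deriveM//=; last first.
    by apply: derivable_powR; rewrite in_itv /= andbT.
  rewrite derive_cst scaler0 addr0 -derive1E powR_derive1 ?in_itv/= ?andbT//.
  by rewrite addrK /GRing.scale /= mulrA mulVf ?mul1r// gt_eqF.
Qed.

Lemma Rintegral_onem_powR (c : R) : 0 < c ->
  \int[leb]_(x in `]0, 1[) ((1 - x) `^ c) = (c + 1)^-1.
Proof.
move=> c0; have cc := derivable_oo_LRcontinuous_within (powR_LRcontinuous c0).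
rewrite -(Rintegral_powR c0) (@Rintegration_by_substitution_onem _ (fun x => x `^ c))//;
  last by rewrite lexx ler01.
rewrite onem1.
have mo : measurable_fun setT (fun x : R => (1 - x) `^ c).
  apply: (@measurableT_comp _ _ _ _ _ _ (fun x => powR x c)); first exact: measurable_powR.
  by apply: measurable_funB => //; exact: measurable_cst.
have io (i : interval R) : [set` i] `<=` `[0, 1]%classic -> measurable [set` i] ->
    leb.-integrable [set` i] (EFin \o (fun x : R => (1 - x) `^ c)).
  move=> i01 mi; apply: (@integrableS _ _ _ leb `[0, 1]%classic) => //.
  apply: measurable_bounded_integrable => //.
  - by rewrite /= lebesgue_measure_itv /= lte_fin ltr01 -EFinB ltry.
  - exact: measurable_funTS.
  exists 1; split; first exact: num_real.
  move=> M M1 x /=; rewrite in_itv /= => /andP[x0 x1].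
  rewrite ger0_norm ?powR_ge0// (le_trans _ (ltW M1))//.
  rewrite [leRHS](_ : _ = 1 `^ c); last by rewrite powR1.
  by apply: ge0_ler_powR; rewrite ?nnegrE; lra.
rewrite Rintegral_itv_bndo_bndc; last first.
  by apply: io => // x /=; rewrite !in_itv /= => /andP[/ltW -> /ltW ->].
rewrite Rintegral_itv_obnd_cbnd// .
by apply: io => // x /=; rewrite !in_itv /= => /andP[/ltW -> ->].
Qed.

Context d (Om : measurableType d) (P : probability Om R).
Local Notation E f := (\int[P]_w f w).
Variables (al : R) (W : Om -> R).
Hypotheses (al1 : 1 < al) (mW : measurable_fun setT W)
  (W01 : forall w, 0 <= W w <= 1)
  (WP : forall U, measurable U -> P (W @^-1` U) = (beta_law 1 al U)%:E).

Let dens (x : R) : R := (1 - x) `^ (al - 1).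

Let al0 : 0 < al. Proof. exact: lt_trans al1. Qed.

Let bdens : {in `]0, 1[, forall x, 0 <= dens x <= 1}.
Proof.
move=> x; rewrite in_itv /= => /andP[x0 x1]; rewrite /dens powR_ge0 /=.
rewrite [leRHS](_ : _ = 1 `^ (al - 1)); last by rewrite powR1.
by have := al1; move=> ?; apply: ge0_ler_powR; rewrite ?nnegrE; lra.
Qed.

Let mdens : measurable_fun setT dens.
Proof.
apply: (@measurableT_comp _ _ _ _ _ _ (fun x => powR x (al - 1))).
  exact: measurable_powR.
by apply: measurable_funB => //; exact: measurable_cst.
Qed.

Let int01 (g : R -> R) : bounded_measurable g ->
  leb.-integrable `]0, 1[ (EFin \o (fun x => g x * dens x)).
Proof.
move=> [mg [M gM]]; apply: measurable_bounded_integrable => //.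
- by rewrite /= lebesgue_measure_itv /= lte_fin ltr01 -EFinB ltry.
- by apply: measurable_funTS; exact: measurable_funM.
exists M; split; first exact: num_real.
move=> M' MM' x /= x01; have /andP[d0 d1] := bdens x01.
rewrite normrM (ger0_norm d0) (le_trans _ (ltW MM'))// (le_trans _ (gM x))//.
by rewrite -[leRHS]mulr1 ler_wpM2l.
Qed.

Lemma exp_beta_density (g : R -> R) : bounded_measurable g ->
  E (g \o W) = al * \int[leb]_(x in `]0, 1[) (g x * dens x).
Proof.
move: g; apply: bounded_linear_eq.
- split.
  + by move=> f g bf bg; exact: (expD P (bm_comp mW bf) (bm_comp mW bg)).
  + by move=> c f bf; exact: (expZ P c (bm_comp mW bf)).
  + exists 1 => // f e bf fe; rewrite mul1r.
    by apply: (exp_normr_le P (bm_comp mW bf)) => w; exact: fe.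
- split.
  + move=> f g bf bg; rewrite -mulrDr -(RintegralD _ (int01 bf) (int01 bg))//.
    by congr (_ * _); apply: eq_Rintegral => x _; rewrite mulrDl.
  + move=> c f bf; rewrite mulrCA -(RintegralZl _ _ (int01 bf))//.
    by congr (_ * _); apply: eq_Rintegral => x _; rewrite mulrA.
  + exists al; first exact: ltW.
    move=> f e bf fe; rewrite normrM (gtr0_norm al0) ler_wpM2l ?(ltW al0)//.
    apply: (le_trans (le_normr_Rintegral _ (int01 bf))) => //.
    have i1 : leb.-integrable `]0, 1[ (EFin \o (fun=> e)).
      apply: measurable_bounded_integrable => //.
        by rewrite /= lebesgue_measure_itv /= lte_fin ltr01 -EFinB ltry.
      by exists `|e|; split; [exact: num_real|move=> M eM x _ /=; exact: ltW].
    apply: (@le_trans _ _ (\int[leb]_(x in `]0, 1[) e)); last first.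
      rewrite Rintegral_cst//= lebesgue_measure_itv /= lte_fin ltr01 -EFinB /=.
      by rewrite subr0 mulr1.
    apply: le_Rintegral => //; first by apply: integrable_norm; exact: int01.
    move=> x x01; have /andP[d0 d1] := bdens x01.
    rewrite normrM (ger0_norm d0) (le_trans _ (fe x))//.
    by rewrite -[leRHS]mulr1 ler_wpM2l.
move=> U mU; rewrite (_ : \1_U \o W = \1_(W @^-1` U)); last first.
  by apply/funext => w; rewrite /= !indicE; congr (nat_of_bool _)%:R;
    apply/idP/idP => /set_mem h; exact/mem_set.
rewrite exp_indic; last by rewrite -[X in measurable X]setTI; exact: mW.
rewrite WP//= /beta_law.
have hE (x : R) : x `^ (1 - 1) * (1 - x) `^ (al - 1) = dens x.
  by rewrite subrr powRr0 mul1r.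
under eq_Rintegral do rewrite hE.
under [X in _ / X = _]eq_Rintegral do rewrite hE.
rewrite [X in _ / X]Rintegral_onem_powR ?subr_gt0// subrK invrK mulrC.
congr (_ * _); rewrite Rintegral_mkcondl; apply: eq_Rintegral => x _.
by rewrite /restrict indicE; case: ifP; rewrite ?mul1r ?mul0r.
Qed.

Lemma exp_beta_onem l : E (fun w => (1 - W w) ^+ l) = al / (al + l%:R).
Proof.
pose g (x : R) := \1_(`[0, 1]%classic : set R) x * (1 - x) ^+ l.
have bg : bounded_measurable g.
  split.
    apply: measurable_funM; first exact: measurable_indic.
    apply: measurable_funX; apply: measurable_funB => //.
  exists 1 => x; rewrite /g indicE; case: (boolP (x \in _)) => [/set_mem|_].
    rewrite /= in_itv /= => /andP[x0 x1]; rewrite mul1r ger0_norm ?exprn_ge0 ?subr_ge0//.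
    by rewrite exprn_ile1//; lra.
  by rewrite mul0r normr0.
have g1 x : 0 <= x <= 1 -> g x = (1 - x) ^+ l.
  by move=> x01; rewrite /g indicE mem_set ?mul1r//= in_itv.
transitivity (E (g \o W)); first by apply: eq_Rintegral => w _; rewrite /= g1.
rewrite exp_beta_density//; congr (_ * _).
have c0 : 0 < al - 1 + l%:R by rewrite ltr_wpDr// subr_gt0.
rewrite (_ : al + l%:R = al - 1 + l%:R + 1); last by ring.
rewrite -(Rintegral_onem_powR c0); apply: eq_Rintegral => x /set_mem /=.
rewrite in_itv /= => /andP[x0 x1].
rewrite g1 ?(ltW x0) ?(ltW x1)// /dens [RHS]powRD; last first.
  by apply/implyP => _; rewrite gt_eqF// subr_gt0.
by rewrite powR_mulrn 1?mulrC// subr_ge0 ltW.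
Qed.

Lemma exp_beta_moment a b :
  E (fun w => W w ^+ a * (1 - W w) ^+ b) = beta_moment al a b.
Proof.
have bW : bounded_measurable W.
  by split=> //; exists 1 => w; have /andP[x y] := W01 w; rewrite ger0_norm.
have b1W : bounded_measurable (fun w => 1 - W w).
  under eq_fun do rewrite -mulN1r.
  by apply: bmD; [exact: bm_cst|exact: bmZ].
have bWW i j : bounded_measurable (fun w => W w ^+ i * (1 - W w) ^+ j).
  by apply: bmM; exact: bmX.
elim: a b => [|a IH] b.
  under eq_Rintegral do rewrite expr0 mul1r.
  rewrite exp_beta_onem /beta_moment fact0 mulr1 add0n risingS.
  have r0 := gt_eqF (rising_gt0 b al0).
  by field; rewrite r0 gt_eqF// ltr_wpDr.
transitivity (E (fun w => W w ^+ a * (1 - W w) ^+ b) -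
              E (fun w => W w ^+ a * (1 - W w) ^+ b.+1)).
  rewrite -mulN1r -expZ// -expD//; last exact: bmZ.
  by apply: eq_Rintegral => w _; rewrite !exprS; ring.
rewrite !IH /beta_moment addSn addnS factS natrM.
have r0 := gt_eqF (rising_gt0 (a + b).+1 al0).
have r1 : al + (a + b).+1%:R != 0 by rewrite gt_eqF// ltr_wpDr.
have e : (a + b).+1%:R = a%:R + b%:R + 1 :> R by rewrite -natr1 natrD.
rewrite (risingS _ b) (risingS _ (a + b).+1) -(natr1 a) e; field.
by rewrite r0 -e r1.
Qed.

End beta_moments.

Section stick_inverse.
Context {R : realType}.
Implicit Types v W : nat -> R.

(* The clipping to [0, 1] only acts on a null event. *)
Definition stick_inv v j : R :=
  Num.max 0 (Num.min 1 (v j / (1 - \sum_(i < j) v i))).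

Lemma stick_inv_itv v j : 0 <= stick_inv v j <= 1.
Proof. by rewrite /stick_inv le_max lexx /= ge_max ler01 ge_min lexx. Qed.

Lemma stick_breaking_sum W j :
  1 - \sum_(i < j) stick_breaking W i = \prod_(i < j) (1 - W i).
Proof.
elim: j => [|j IH]; first by rewrite !big_ord0 subr0.
rewrite !big_ord_recr /= opprD addrA IH /stick_breaking; ring.
Qed.

Lemma stick_breakingK W j : (forall i, 0 < W i < 1) ->
  stick_inv (stick_breaking W) j = W j.
Proof.
move=> W01; rewrite /stick_inv stick_breaking_sum /stick_breaking mulfK.
  have /andP[w0 w1] := W01 j.
  by rewrite min_r ?(ltW w1)// max_r// ltW.
by rewrite gt_eqF// prodr_gt0// => i _; have /andP[_ w1] := W01 i; rewrite subr_gt0.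
Qed.

Lemma stick_invK v : (forall i, 0 < stick_inv v i < 1) ->
  stick_breaking (stick_inv v) =1 v.
Proof.
move=> v01.
have E j : v j = stick_inv v j * (1 - \sum_(i < j) v i).
  have /andP[] := v01 j; rewrite /stick_inv.
  set q := v j / _; rewrite lt_max ltxx /= lt_min ltr01 /= => q0 q1.
  have {q1} qlt : q < 1.
    move: q1; rewrite gt_max ltr01 /= gt_min ltxx /=; exact.
  rewrite min_r ?(ltW qlt)// max_r ?(ltW q0)// /q divfK//.
  by apply: contraTneq q0 => d0; rewrite /q d0 invr0 mulr0 ltxx.
have S j : \prod_(i < j) (1 - stick_inv v i) = 1 - \sum_(i < j) v i.
  elim: j => [|j IH]; first by rewrite !big_ord0 subr0.
  by rewrite !big_ord_recr /= IH [in RHS](E j); ring.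
by move=> j; rewrite /stick_breaking S -E.
Qed.

End stick_inverse.

Section sequence_space.
Context d (T : measurableType d).

Definition seq_gen : set (set (nat -> T)) :=
  \bigcup_(i in setT) preimage_set_system setT (fun x : nat -> T => x i) measurable.

Definition seq_space := g_sigma_algebraType seq_gen.

Lemma product_sigmaE : @product_sigma d T = @measurable _ seq_space.
Proof. by []. Qed.

Lemma measurable_coord i : measurable_fun setT (fun x : seq_space => x i : T).
Proof.
move=> _ B mB; apply: sub_sigma_algebra; exists i => //.
by exists B.
Qed.

Lemma measurable_seq_fun d' (U : measurableType d') (f : U -> nat -> T) :
  (forall i, measurable_fun setT (fun u => f u i)) ->
  measurable_fun setT (f : U -> seq_space).
Proof.
move=> mf; apply: (@measurability _ _ U (g_sigma_algebraType seq_gen) setT f seq_gen) => // _ [_ [i _ [B mB <-]] <-].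
by have := mf i measurableT B mB; rewrite !setTI.
Qed.

End sequence_space.

Lemma sigma_family_preimage d (T : measurableType d) (U : pointedType)
    (Y : nat -> U -> T) (B : set (nat -> T)) : product_sigma B ->
  sigma_family setT Y ((fun u j => Y j u) @^-1` B).
Proof.
move=> mB.
pose G := \bigcup_(i in setT) preimage_set_system setT (Y i) (@measurable _ T).
have mY : measurable_fun setT ((fun u j => Y j u) : g_sigma_algebraType G -> seq_space T).
  apply: measurable_seq_fun => i _ C mC; apply: sub_sigma_algebra.
  by exists i => //; exists C.
by have := mY measurableT B mB; rewrite setTI.
Qed.

Lemma big_fset_iota (R : Type) (idx : R) (op : Monoid.com_law idx) s (f : nat -> R) :
  \big[op/idx]_(j <- [fset x in iota 0 s]%fset) f j = \big[op/idx]_(j < s) f j.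
Proof.
rewrite -(big_mkord xpredT) /index_iota subn0; apply: perm_big.
apply: uniq_perm; rewrite ?iota_uniq ?fset_uniq// => j.
by rewrite inE.
Qed.

Lemma bigcap_fset_iota (U : Type) s (F : nat -> set U) :
  \bigcap_(j in [set` [fset x in iota 0 s]%fset]) F j =
  [set u | forall j, (j < s)%N -> F j u].
Proof.
apply/seteqP; split => u /= Fu j.
  by move=> js; apply: Fu; rewrite /= inE mem_iota.
by rewrite /= inE mem_iota /= add0n => /Fu.
Qed.

Lemma measurable_inv (R : realType) : measurable_fun setT (fun x : R => x^-1).
Proof.
rewrite (_ : (fun x : R => x^-1) =
    (fun x => if 0 <= x then x `^ (-1) else - (- x) `^ (-1))); last first.
  apply/funext => x; case: (leP 0 x) => x0; first by rewrite powR_inv1.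
  by rewrite powR_inv1 ?invrN ?opprK// oppr_ge0 ltW.
apply: measurable_fun_ifT.
- by apply: measurable_fun_ler => //; exact: measurable_cst.
- exact: measurable_powR.
- apply: measurable_funN; apply: (@measurableT_comp _ _ _ _ _ _ (fun x => powR x (-1))).
    exact: measurable_powR.
  exact: measurable_funN.
Qed.

Section stick_law.
Context {R : realType}.
Variables (al : R).
Hypothesis al1 : 1 < al.

Lemma measurable_stick_inv j :
  measurable_fun setT (fun v : seq_space R => stick_inv v j).
Proof.
apply: measurable_maxr; first exact: measurable_cst.
apply: measurable_minr; first exact: measurable_cst.
apply: measurable_funM; first exact: measurable_coord.
apply: (@measurableT_comp _ _ _ _ _ _ (fun x : R => x^-1)).
  exact: measurable_inv.
apply: measurable_funB; first exact: measurable_cst.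
by apply: measurable_sum => i; exact: measurable_coord.
Qed.

Lemma beta_law_itv (U : set R) : measurable U -> `]0, 1[%classic `<=` U ->
  beta_law 1 al U = 1.
Proof.
move=> mU U01; rewrite /beta_law setIidr//.
under eq_Rintegral do rewrite subrr powRr0 mul1r.
by rewrite Rintegral_onem_powR ?subr_gt0// subrK divff// invr_eq0 gt_eqF// (lt_trans _ al1).
Qed.

Definition stick_cylinder s (B : nat -> set R) : set (nat -> R) :=
  [set v | forall j, (j < s)%N -> B j (stick_inv v j)].

Lemma measurable_stick_cylinder s B : (forall j, measurable (B j)) ->
  product_sigma (stick_cylinder s B).
Proof.
move=> mB; rewrite product_sigmaE.
have -> : stick_cylinder s B =
    \bigcap_(j in [set j | (j < s)%N]) ((fun v => stick_inv v j) @^-1` B j).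
  by apply/seteqP; split.
apply: bigcap_measurableType.
move=> j _; rewrite -[X in measurable X]setTI.
exact: (measurable_stick_inv j).
Qed.

Lemma stick_breaking_law_cylinder L s B : stick_breaking_law al L ->
  (forall j, measurable (B j)) ->
  L (stick_cylinder s B) = \prod_(j < s) beta_law 1 al (B j).
Proof.
move=> [d [Om [P [W [ind WP LP]]]]] mB.
rewrite LP; last exact: measurable_stick_cylinder.
have ae01 : {ae P, forall w, forall j, 0 < W j w < 1}.
  apply: ae_foralln => j; exists (W j @^-1` ~` `]0, 1[%classic); split.
  - by rewrite -[X in measurable X]setTI; apply: (measurable_funP (W j)) => //; apply: measurableC; exact: measurable_itv.
  - have mW : measurable (W j @^-1` `]0, 1[%classic).
      by rewrite -[X in measurable X]setTI; exact: measurable_funP.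
    rewrite preimage_setC; apply: (etrans (probability_setC P mW)).
    by rewrite WP// beta_law_itv// subee.
  - by move=> w /= nW; rewrite in_itv.
have mC : measurable [set w | stick_cylinder s B (stick_breaking (fun j => W j w))].
  have mS : measurable_fun setT
      ((fun w => stick_breaking (fun j => W j w)) : Om -> seq_space R).
    apply: measurable_seq_fun => i; apply: measurable_funM => //.
    apply: measurable_prod => k _; apply: measurable_funB => //.
  by have := mS measurableT _ (measurable_stick_cylinder s mB); rewrite setTI.
have mI : measurable [set w | forall j, (j < s)%N -> B j (W j w)].
  rewrite [X in measurable X](_ : _ =
      \bigcap_(j in [set j | (j < s)%N]) (W j @^-1` B j)); last by apply/seteqP; split.
  apply: bigcap_measurableType.
  by move=> j _; rewrite -[X in measurable X]setTI; exact: measurable_funP.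
transitivity (fine (P [set w | forall j, (j < s)%N -> B j (W j w)])).
  rewrite -!exp_indic//; apply: exp_ae_eq; [exact: bm_indic..|].
  apply: filterS ae01 => w W01; rewrite !indicE; congr (nat_of_bool _)%:R.
  by apply/idP/idP => /set_mem h; apply/mem_set => j js; have := h j js;
    rewrite stick_breakingK.
have := ind [fset x in iota 0 s]%fset B mB.
rewrite bigcap_fset_iota => ->; rewrite big_fset_iota.
by apply: eq_bigr => j _; rewrite WP.
Qed.

End stick_law.

(** * The class L as an urn *)

Section random_measures.
Context d (Om : measurableType d) dS (S : measurableType dS) (R : realType).

Lemma measurable_pprobability (m : Om -> pprobability S R) :
  (forall A, measurable A -> measurable_fun setT (fun w => fine (m w A))) ->
  measurable_fun setT m.
Proof.
move=> mm; apply: (measurability (@pset _ S R : set (set (pprobability S R)))) => //.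
move=> _ [_ [r _] [A mA] <-] <-; rewrite setTI.
rewrite [X in measurable X](_ : _ = [set w | fine (m w A) < r]).
  by apply: measurable_lt_set; exact: mm.
apply/seteqP; split => w; rewrite /mset /= -lte_fin fineK ?fin_num_measure//.
Qed.

Lemma measurable_pprobability_eval (m : Om -> pprobability S R) A :
  measurable_fun setT m -> measurable A ->
  measurable_fun setT (fun w => fine (m w A)).
Proof.
move=> mm mA; apply: measurableT_comp => //.
exact: (measurable_kernel (kprobability mm) A mA).
Qed.

End random_measures.

Lemma fine_probability_itv d (S : measurableType d) (R : realType)
  (p : probability S R) A : measurable A -> 0 <= fine (p A) <= 1.
Proof.
move=> mA; rewrite fine_ge0//= -lee_fin fineK ?fin_num_measure//.
exact: probability_le1.
Qed.

Section invariant_kernel.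
Context dS (S : measurableType dS) (R : realType) (nu : probability S R)
  (K : S -> probability S R) (G : set (set S)).
Hypotheses (sG : sigma_algebra setT G) (Gm : G `<=` measurable)
  (rK : regular_cond_distr nu G K).

Lemma measurable_sub_sigma (A : set S) :
  measurable (A : set (g_sigma_algebraType G)) = G A.
Proof.
by have := congr1 (fun F : set (set S) => F A) (sigma_algebra_id sG).
Qed.

Let mK A : measurable A -> measurable_fun setT (fun x => K x A).
Proof.
move=> mA _ B mB; apply: Gm; apply: rK.1 mA _ _.
by exists B.
Qed.

Let ae_null_of_integral (D A : set S) : measurable D -> measurable A ->
  (\int[nu]_(x in D) K x A = 0)%E -> {ae nu, forall x, D x -> K x A = 0%E}.
Proof.
move=> mD mA i0.
have /(ae_eq_integral_abs nu mD) : measurable_fun D (fun x => K x A).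
  by apply: measurable_funTS; exact: mK.
have -> : (\int[nu]_(x in D) `|K x A| = \int[nu]_(x in D) K x A)%E.
  by apply: eq_integral => x _; rewrite gee0_abs.
by move=> [/(_ i0)].
Qed.

Lemma ae_kernel_null A : measurable A -> nu A = 0%E ->
  {ae nu, forall x, K x A = 0%E}.
Proof.
move=> mA A0; have GT : G setT.
  by have [G0 GC _] := sG; rewrite -(setD0 setT); exact: GC.
have := rK.2 _ _ mA GT; rewrite setIT A0 => /esym /(ae_null_of_integral measurableT mA).
by apply: filterS => x /(_ I).
Qed.

Lemma ae_kernel_indic C : G C ->
  {ae nu, forall x, fine (K x C) = \1_C x}.
Proof.
move=> GC.
have GCC B : G B -> G (~` B) by have [_ GC' _] := sG; rewrite -setTD; exact: GC'.
have outside B : G B -> {ae nu, forall x, (~` B) x -> K x B = 0%E}.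
  move=> GB; apply: ae_null_of_integral; [exact: Gm (GCC _ GB)|exact: Gm|].
  by rewrite -rK.2//; [rewrite setICr measure0|exact: Gm|exact: GCC].
have := outside _ GC; have := outside _ (GCC _ GC).
apply: filterS2 => x; rewrite setCK => xC xnC; rewrite indicE.
have [/set_mem Cx|nCx] := boolP (x \in C).
  by have := probability_setC (K x) (Gm (GCC _ GC)); rewrite setCK xC// sube0 => ->.
by rewrite xnC// => Cx; move: nCx; rewrite mem_set.
Qed.

End invariant_kernel.

Section class_L_urn.
Context d (Om : measurableType d) (R : realType) (P : probability Om R)
  dS (S : measurableType dS) (X : nat -> {RV P >-> S}) (nu : probability S R)
  (theta : R) (K : {mfun S >-> pprobability S R}) (G : set (set S)).
Local Notation E f := (\int[P]_w f w).
Hypotheses (theta0 : 0 < theta) (sG : sigma_algebra setT G) (Gm : G `<=` measurable)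
  (rK : regular_cond_distr nu G K)
  (X0 : forall A, measurable A -> P (X 0%N @^-1` A) = nu A)
  (XP : forall n A, (0 < n)%N -> measurable A ->
    cond_prob P (sigma_family `I_n X) (X n @^-1` A)
      (fun w => predictive nu theta K X n w A)).

Let mX i A : measurable A -> measurable (X i @^-1` A).
Proof. by move=> mA; rewrite -[_ @^-1` _]setTI; exact: measurable_funP. Qed.

Lemma measurable_eval (xi : Om -> S) A : measurable_fun setT xi -> measurable A ->
  measurable_fun setT (fun w => fine (K (xi w) A)).
Proof.
move=> mxi mA; apply: measurable_pprobability_eval => //.
by apply: measurableT_comp.
Qed.

Lemma bm_eval (xi : Om -> S) A : measurable_fun setT xi -> measurable A ->
  bounded_measurable (fun w => fine (K (xi w) A)).
Proof.
move=> mxi mA; split; first exact: measurable_eval.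
by exists 1 => w; have /andP[a b] := fine_probability_itv (K (xi w)) mA; rewrite ger0_norm.
Qed.

Lemma bm_predictive n A : measurable A ->
  bounded_measurable (fun w => predictive nu theta K X n w A).
Proof.
move=> mA; apply: bmM; last exact: bm_cst.
apply: bmD; first exact: bm_cst.
by apply: bm_sum => i; apply: bm_eval.
Qed.

Lemma sub_sigma_family n : sigma_family `I_n X `<=` @measurable _ Om.
Proof.
apply: smallest_sub; first exact: sigma_algebra_measurable.
by move=> _ [i _ [A mA <-]]; rewrite setTI; exact: mX.
Qed.

Lemma sigma_familyT n : sigma_family `I_n X setT.
Proof.
exact: (@measurableT _ (g_sigma_algebraType
  (\bigcup_(i in `I_n) preimage_set_system setT (X i) (@measurable _ S)))).
Qed.

Lemma cond_probE n (D : set Om) f H : cond_prob P (sigma_family `I_n X) D f ->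
  sigma_family `I_n X H -> E (fun w => \1_H w * f w) = fine (P (D `&` H)).
Proof. by move=> [_ _ /[apply] <-]; rewrite -exp_restrict. Qed.

Lemma ae_X_null i A : measurable A -> nu A = 0%E -> P (X i @^-1` A) = 0%E.
Proof.
elim/ltn_ind: i A => -[|n] IH A mA A0; first by rewrite X0.
have := cond_probE (XP (ltn0Sn n) mA) (@sigma_familyT n.+1); rewrite setIT => e.
rewrite -[LHS]fineK ?fin_num_measure//; last exact: mX.
rewrite -e; congr (_%:E); transitivity (E (fun=> 0)); last exact: exp_cst.
apply: exp_ae_eq; [|exact: bm_cst|].
  by apply: bmM; [apply: bm_indic; exact: measurableT|exact: bm_predictive].
have : {ae P, forall w, forall j, (j < n.+1)%N -> K (X j w) A = 0%E}.
  apply: ae_foralln => j; have [jn|jn] := leqP n.+1 j.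
    exact: aeW.
  have [N [mN N0 sN]] := ae_kernel_null sG Gm rK mA A0.
  exists (X j @^-1` N); split; [exact: mX|exact: IH|].
  by move=> w /= nw; apply: sN => /= KA; apply: nw => _.
apply: filterS => w Kw; rewrite /predictive A0 /= mulr0 add0r.
by rewrite big1 ?mul0r ?mulr0// => j _; rewrite Kw.
Qed.

Lemma ae_X i (Q : S -> Prop) : {ae nu, forall x, Q x} -> {ae P, forall w, Q (X i w)}.
Proof.
move=> [N [mN N0 sN]]; exists (X i @^-1` N); split; [exact: mX|exact: ae_X_null|].
by move=> w nQ; exact: sN.
Qed.

Lemma exp_X0 (f : S -> R) : bounded_measurable f -> E (f \o X 0%N) = \int[nu]_x f x.
Proof.
move: f; apply: bounded_linear_eq.
- split.
  + by move=> f g bf bg; exact: (expD P (bm_comp (measurable_funP (X 0%N)) bf) (bm_comp (measurable_funP (X 0%N)) bg)).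
  + by move=> c f bf; exact: (expZ P c (bm_comp (measurable_funP (X 0%N)) bf)).
  + exists 1 => // f e bf fe; rewrite mul1r.
    by apply: (exp_normr_le P (bm_comp (measurable_funP (X 0%N)) bf)) => w; exact: fe.
- split.
  + by move=> f g bf bg; exact: expD.
  + by move=> c f bf; exact: expZ.
  + by exists 1 => // f e bf fe; rewrite mul1r; exact: exp_normr_le.
move=> A mA; rewrite (_ : \1_A \o X 0%N = \1_(X 0%N @^-1` A)); last first.
  by apply/funext => w; rewrite /= !indicE; congr (nat_of_bool _)%:R;
    apply/idP/idP => /set_mem h; exact/mem_set.
by rewrite !exp_indic ?X0//; exact: mX.
Qed.

Lemma exp_kernel_X0 A : measurable A ->
  E (fun w => fine (K (X 0%N w) A)) = fine (nu A).
Proof.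
move=> mA; have GT : G setT.
  by have [G0 GC _] := sG; rewrite -(setD0 setT); exact: GC.
have bK : bounded_measurable (fun x => fine (K x A)).
  split; first by apply: (measurable_pprobability_eval (m := K)).
  by exists 1 => x; have /andP[a b] := fine_probability_itv (K x) mA; rewrite ger0_norm.
rewrite (exp_X0 bK) /Rintegral; congr fine.
have := rK.2 _ _ mA GT; rewrite setIT => ->.
by apply: eq_integral => x _; rewrite fineK// fin_num_measure.
Qed.

Local Notation SG := (g_sigma_algebraType G).

Lemma measurable_fun_sub (xi : Om -> S) :
  measurable_fun setT xi -> measurable_fun setT (xi : Om -> SG).
Proof.
move=> mxi _ B; rewrite (measurable_sub_sigma sG) => GB.
by apply: mxi => //; exact: Gm.
Qed.

(* On G-measurable functions, the predictive distribution is that of a Polya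
   urn. *)
Definition urn_mean n (h : SG -> R) (w : Om) : R :=
  (theta * E (h \o X 0%N) + \sum_(i < n) h (X i w)) / (n%:R + theta).

Let mXG i : measurable_fun setT (X i : Om -> SG).
Proof. by apply: measurable_fun_sub. Qed.

Let nt0 n : 0 < n%:R + theta. Proof. by rewrite ltr_wpDl. Qed.

Lemma bounded_operator_urn_mean n : bounded_operator (urn_mean n).
Proof.
have bX (h : SG -> R) i : bounded_measurable h -> bounded_measurable (h \o (X i : Om -> SG)).
  by move=> bh; exact: bm_comp.
split.
- move=> h bh; apply: bmM; last exact: bm_cst.
  apply: bmD; first exact: bm_cst.
  by apply: bm_sum => i; exact: bX.
- move=> h k w bh bk; rewrite /urn_mean -mulrDl; congr (_ / _).
  have -> : E ((fun x => h x + k x) \o X 0%N) = E (h \o X 0%N) + E (k \o X 0%N).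
    exact: (expD P (bX h 0%N bh) (bX k 0%N bk)).
  by rewrite big_split /=; ring.
- move=> c h w bh; rewrite /urn_mean mulrA mulrDr; congr (_ / _).
  have -> : E ((fun x => c * h x) \o X 0%N) = c * E (h \o X 0%N).
    exact: (expZ P c (bX h 0%N bh)).
  by rewrite mulr_sumr; ring.
move=> h e w bh he; rewrite /urn_mean normrM normfV (gtr0_norm (nt0 n)).
rewrite ler_pdivrMr// (le_trans (ler_normD _ _))// mulrDr addrC.
apply: lerD; last first.
  rewrite normrM (gtr0_norm theta0) mulrC ler_wpM2r ?(ltW theta0)//.
  by apply: (exp_normr_le P (bX h 0%N bh)) => w'; exact: he.
apply: (le_trans (ler_norm_sum _ _ _)).
apply: (@le_trans _ _ (\sum_(i < n) e)); first by apply: ler_sum => i _; exact: he.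
by rewrite sumr_const card_ord mulr_natr.
Qed.

Lemma ae_predictive n C : G C ->
  {ae P, forall w, predictive nu theta K X n w C = urn_mean n \1_C w}.
Proof.
move=> GC.
have : {ae P, forall w, forall j, fine (K (X j w) C) = \1_C (X j w)}.
  by apply: ae_foralln => j; apply: (ae_X j (ae_kernel_indic sG Gm rK GC)).
apply: filterS => w Kw; rewrite /predictive /urn_mean; congr ((_ + _) / _).
  have bC : bounded_measurable (\1_C : S -> R) by apply: bm_indic; exact: Gm.
  by rewrite (exp_X0 bC) exp_indic//; exact: Gm.
by apply: eq_bigr => i _; rewrite Kw.
Qed.

Local Notation FT n := (g_sigma_algebraType
  (\bigcup_(i in `I_n) preimage_set_system setT (X i) (@measurable _ S))).

Definition adapted n (f : Om -> R) := bounded_measurable (f : FT n -> R).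

Let mid n : measurable_fun setT (id : Om -> FT n).
Proof. by move=> _ B mB; rewrite setTI; exact: (@sub_sigma_family n). Qed.

Lemma adapted_bm n f : adapted n f -> bounded_measurable f.
Proof. by move=> af; have := bm_comp (@mid n) af. Qed.

Lemma adapted_indic n H : sigma_family `I_n X H -> adapted n \1_H.
Proof. by move=> HF; exact: bm_indic. Qed.

Lemma adapted_X n i (h : SG -> R) : (i < n)%N -> bounded_measurable h ->
  adapted n (h \o X i).
Proof.
move=> ni bh; apply: bm_comp bh => _ B.
rewrite (measurable_sub_sigma sG) => GB; rewrite setTI.
apply: sub_sigma_algebra; exists i => //; exists B; [exact: Gm|by rewrite setTI].
Qed.

Lemma sigma_family_le n m : (n <= m)%N -> sigma_family `I_n X `<=` sigma_family `I_m X.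
Proof.
move=> nm; apply: smallest_sub; first exact: smallest_sigma_algebra.
move=> A [i ni HA]; apply: sub_sigma_algebra.
by exists i => //; exact: leq_trans nm.
Qed.

Lemma exp_urn n (h : SG -> R) f : (0 < n)%N -> bounded_measurable h -> adapted n f ->
  E (fun w => f w * h (X n w)) = E (fun w => f w * urn_mean n h w).
Proof.
move=> n0 bh af.
have bhX : bounded_measurable (h \o (X n : Om -> SG)) by exact: bm_comp.
have [um _ _ _] := bounded_operator_urn_mean n.
have sets H : sigma_family `I_n X H ->
    E (fun w => \1_H w * h (X n w)) = E (fun w => \1_H w * urn_mean n h w).
  move=> HF; have mH : measurable H by exact: (@sub_sigma_family n).
  have bH : bounded_measurable (\1_H : Om -> R) by exact: bm_indic.
  apply: (@bounded_linear_eq _ _ _ (fun h : SG -> R => E (fun w => \1_H w * h (X n w)))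
    (fun h => E (fun w => \1_H w * urn_mean n h w))) bh.
  - exact: (bounded_linear_exp P (bounded_operator_comp R (mXG n)) bH).
  - exact: (bounded_linear_exp P (bounded_operator_urn_mean n) bH).
  move=> C; rewrite (measurable_sub_sigma sG) => GC.
  have mC := Gm GC; have mXC : measurable (X n @^-1` C) by exact: mX.
  transitivity (fine (P (X n @^-1` C `&` H))).
    rewrite -exp_indic; last exact: measurableI.
    by apply: eq_Rintegral => w _; rewrite indicI mulrC.
  rewrite -(cond_probE (XP n0 mC) HF); apply: exp_ae_eq.
  - by apply: bmM => //; exact: bm_predictive.
  - by apply: bmM => //; apply: um; apply: bm_indic; rewrite (measurable_sub_sigma sG).
  by apply: filterS (ae_predictive n GC) => w ->.
transitivity (E (fun w => h (X n w) * f w)).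
  by apply: eq_Rintegral => w _; rewrite mulrC.
transitivity (E (fun w => urn_mean n h w * f w)); last first.
  by apply: eq_Rintegral => w _; rewrite mulrC.
have bo := bounded_operator_comp R (@mid n).
apply: (@bounded_linear_eq _ _ _ (fun f : FT n -> R => E (fun w => h (X n w) * f w))
    (fun f => E (fun w => urn_mean n h w * f w))) af.
- exact: (bounded_linear_exp P bo bhX).
- exact: (bounded_linear_exp P bo (um _ bh)).
move=> H HF; have := sets H HF; under eq_Rintegral do rewrite mulrC.
by under [X in _ = X -> _]eq_Rintegral do rewrite mulrC.
Qed.

End class_L_urn.

Lemma exp_eq0 d (Om : measurableType d) (R : realType) (P : probability Om R)
    (f : Om -> R) : P.-integrable setT (EFin \o f) -> (forall w, 0 <= f w) ->
  \int[P]_w f w = 0 -> {ae P, forall w, f w = 0}.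
Proof.
move=> fi f0 Ef; have mf := measurable_int P fi.
have [+ _] := ae_eq_integral_abs P measurableT mf; move=> h.
have : (\int[P]_w `|(EFin \o f) w| = 0)%E.
  transitivity (\int[P]_w (f w)%:E)%E.
    by apply: eq_integral => w _; rewrite /= ger0_norm.
  rewrite -[LHS]fineK; last exact: integrable_fin_num.
  by congr (_%:E).
move=> /h; apply: filterS => w /(_ I) /= e.
exact: EFin_inj e.
Qed.

Section stick_urn.
Context d (Om : measurableType d) (R : realType) (P : probability Om R)
  dS (S : measurableType dS) (X : nat -> {RV P >-> S}) (nu : probability S R)
  (theta : R) (K : {mfun S >-> pprobability S R}) (G : set (set S)).
Local Notation E f := (\int[P]_w f w).
Hypotheses (theta0 : 0 < theta) (sG : sigma_algebra setT G) (Gm : G `<=` measurable)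
  (rK : regular_cond_distr nu G K)
  (X0 : forall A, measurable A -> P (X 0%N @^-1` A) = nu A)
  (XP : forall n A, (0 < n)%N -> measurable A ->
    cond_prob P (sigma_family `I_n X) (X n @^-1` A)
      (fun w => predictive nu theta K X n w A)).
Variables (n : nat) (V : nat -> {RV P >-> R}) (Z : nat -> {RV P >-> S}).
Hypotheses (n0 : (0 < n)%N)
  (VZ_indep : cond_indep_sigma P (sigma_family `I_n X)
    (sigma_family setT V) (sigma_family setT Z))
  (V_law : exists2 L, stick_breaking_law (n%:R + theta) L &
    forall B, product_sigma B ->
      cond_prob P (sigma_family `I_n X) [set w | B (fun j => V j w)] (fun=> L B))
  (Z_indep : cond_mutual_indep P (sigma_family `I_n X) Z)
  (Z_law : forall j A, measurable A ->
    cond_prob P (sigma_family `I_n X) (Z j @^-1` A)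
      (fun w => predictive nu theta K X n w A)).
Local Notation SG := (g_sigma_algebraType G).
Local Notation al := (n%:R + theta).
Local Notation um := (@urn_mean d Om R P dS S X theta G n).
Local Notation FF := (sigma_family `I_n X).

Let al1 : 1 < al.
Proof. by rewrite ltr_pwDr// ler1n. Qed.

Definition stick_ratio j (w : Om) : R := stick_inv (fun i => V i w) j.
Local Notation W := stick_ratio.

Let mV : measurable_fun setT ((fun w j => V j w) : Om -> seq_space R).
Proof. by apply: measurable_seq_fun. Qed.

Lemma measurable_stick_ratio j : measurable_fun setT (W j).
Proof. exact: (measurableT_comp (measurable_stick_inv j) mV). Qed.

Let mZ j : measurable_fun setT (Z j : Om -> SG).
Proof. by apply: measurable_fun_sub. Qed.

Let bo_um := bounded_operator_urn_mean X theta0 sG Gm n.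

Let bum (h : SG -> R) : bounded_measurable h ->
  bounded_measurable (um h).
Proof. by have [+ _ _ _] := bo_um; apply. Qed.

Let mZcyl s (C : nat -> set S) : (forall j, measurable (C j)) ->
  product_sigma [set z : nat -> S | forall j, (j < s)%N -> C j (z j)].
Proof.
move=> mC; rewrite product_sigmaE.
rewrite [X in measurable X](_ : _ =
  \bigcap_(j in [set j | (j < s)%N]) ((fun z : seq_space S => z j) @^-1` C j)); last first.
  by apply/seteqP; split.
apply: bigcap_measurableType => j _; rewrite -[X in measurable X]setTI.
exact: (measurable_coord j).
Qed.

Let joint_prob s (B : nat -> set R) (C : nat -> set S) H :
  (forall j, measurable (B j)) -> (forall j, G (C j)) -> FF H ->
  fine (P ([set w | forall j, (j < s)%N -> B j (W j w)] `&`
           [set w | forall j, (j < s)%N -> C j (Z j w)] `&` H)) =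
  \prod_(j < s) beta_law 1 al (B j) *
  E (fun w => \1_H w * \prod_(j < s) um \1_(C j) w).
Proof.
move=> mB GC HF; have mC j : measurable (C j) by exact: Gm.
have [L lawL LP] := V_law.
have cB := measurable_stick_cylinder s mB.
have cV := LP _ cB.
have cZ := @Z_indep [fset x in iota 0 s]%fset C
  (fun j w => predictive nu theta K X n w (C j)) mC (fun j => Z_law j (mC j)).
rewrite bigcap_fset_iota in cZ.
have sV := sigma_family_preimage (Y := fun j => V j : Om -> R) cB.
have sZ := sigma_family_preimage (Y := fun j => Z j : Om -> S) (mZcyl s mC).
have c := VZ_indep sV sZ cV cZ.
have := cond_probE c HF => <-.
rewrite (stick_breaking_law_cylinder al1 s lawL mB) -expZ; last first.
  apply: bmM; first by apply: bm_indic; exact: (sub_sigma_family HF).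
  apply: bm_prod => j; apply: bum; apply: bm_indic.
  by rewrite (measurable_sub_sigma sG).
apply: exp_ae_eq.
- apply: bmM; first by apply: bm_indic; exact: (sub_sigma_family HF).
  by apply: bmZ; apply: bm_prod => j; exact: bm_predictive.
- apply: bmZ; apply: bmM; first by apply: bm_indic; exact: (sub_sigma_family HF).
  apply: bm_prod => j; apply: bum; apply: bm_indic.
  by rewrite (measurable_sub_sigma sG).
have : {ae P, forall w, forall j,
    predictive nu theta K X n w (C j) = um \1_(C j) w}.
  by apply: ae_foralln => j; apply: (ae_predictive sG Gm rK X0 XP n (GC j)).
apply: filterS => w pw; rewrite big_fset_iota mulrCA; congr (_ * (_ * _)).
by apply: eq_bigr => j _; rewrite pw.
Qed.

Let GT : G setT.
Proof. by have [G0 GC _] := sG; rewrite -(setD0 setT); exact: GC. Qed.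

Lemma urn_mean_cst1 w : um (fun=> 1) w = 1.
Proof.
rewrite /urn_mean sumr_const card_ord /comp exp_cst mulr1 addrC divff//.
by rewrite gt_eqF// (lt_trans _ al1).
Qed.

Lemma stick_ratio_law j U : measurable U ->
  P (W j @^-1` U) = (beta_law 1 al U)%:E.
Proof.
move=> mU; pose B i := if i == j then U else setT.
have mB i : measurable (B i) by rewrite /B; case: eqP.
have := @joint_prob j.+1 B (fun=> setT) setT mB (fun=> GT) (@sigma_familyT _ _ _ _ _ _ X n).
rewrite setIT (_ : [set w | _] `&` _ = W j @^-1` U); last first.
  apply/seteqP; split => w /= => [[h _]|h].
    by have := h j (ltnSn j); rewrite /B eqxx.
  by split=> // i _; rewrite /B; case: eqP => [->|].
have -> : E (fun w => \1_setT w *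
    \prod_(i < j.+1) um \1_([set: S]) w) = 1.
  rewrite -[RHS](exp_cst P); apply: eq_Rintegral => w _.
  rewrite indicE mem_set// mul1r big1// => i _.
  rewrite (_ : \1_[set: S] = fun=> 1) ?urn_mean_cst1//.
  by apply/funext => x; rewrite indicE mem_set.
rewrite mulr1 big_ord_recr /= {2}/B eqxx big1 ?mul1r => [|i _]; last first.
  by rewrite /B ltn_eqF ?ltn_ord// beta_law_itv.
move=> <-; rewrite fineK// fin_num_measure//.
by rewrite -[_ @^-1` _]setTI; exact: measurable_stick_ratio.
Qed.

Lemma stick_ratio_itv w j : 0 <= W j w <= 1.
Proof. exact: stick_inv_itv. Qed.

Lemma exp_joint_factor s H (f : nat -> R -> R) (g : nat -> SG -> R) :
  FF H -> (forall j, bounded_measurable (f j)) -> (forall j, bounded_measurable (g j)) ->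
  E (fun w => \1_H w * \prod_(j < s) f j (W j w) * \prod_(j < s) g j (Z j w)) =
  E (fun w => \1_H w * \prod_(j < s) E (f j \o W j) *
    \prod_(j < s) um (g j) w).
Proof.
move=> HF bf bg; have mH := sub_sigma_family HF.
have bH : bounded_measurable (\1_H : Om -> R) by exact: bm_indic.
have bfW (k : nat -> R -> R) j : bounded_measurable (k j) ->
    bounded_measurable (k j \o W j).
  by move=> bk; apply: bm_comp => //; exact: measurable_stick_ratio.
apply: (exp_prod_ext (P := P) (Phi := fun j (h : SG -> R) => h \o Z j)
  (Psi := fun j => um)
  (Y := fun w => \1_H w * \prod_(j < s) f j (W j w))
  (Y' := fun w => \1_H w * \prod_(j < s) E (f j \o W j))) => //.
- by move=> j; exact: bounded_operator_comp.
- by apply: bmM => //; apply: bm_prod => j; exact: bfW.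
- by apply: bmM => //; exact: bm_cst.
move=> C GC'; have GC j : G (C j) by rewrite -(measurable_sub_sigma sG); exact: GC'.
have bC j : bounded_measurable (\1_(C j) : SG -> R) by exact: bm_indic.
have bCZ j : bounded_measurable ((\1_(C j) : SG -> R) \o Z j) by exact: bm_comp.
transitivity (E (fun w => (\1_H w * \prod_(j < s) (\1_(C j) : SG -> R) (Z j w)) *
    \prod_(j < s) f j (W j w))).
  by apply: eq_Rintegral => w _; rewrite mulrAC.
transitivity (E (fun w => (\1_H w * \prod_(j < s) um \1_(C j) w) *
    \prod_(j < s) E (f j \o W j))); last first.
  by apply: eq_Rintegral => w _; rewrite mulrAC.
apply: (exp_prod_ext (P := P) (Phi := fun j (h : R -> R) => h \o W j)
  (Psi := fun j h _ => E (h \o W j))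
  (Y := fun w => \1_H w * \prod_(j < s) (\1_(C j) : SG -> R) (Z j w))
  (Y' := fun w => \1_H w * \prod_(j < s) um \1_(C j) w)) => //.
- by move=> j; apply: bounded_operator_comp; exact: measurable_stick_ratio.
- by move=> j; apply: bounded_operator_exp; exact: measurable_stick_ratio.
- by apply: bmM => //; apply: bm_prod => j; exact: bCZ.
- by apply: bmM => //; apply: bm_prod => j; exact: bum.
move=> B mB.
have mWB j : measurable (W j @^-1` B j).
  by rewrite -[_ @^-1` _]setTI; apply: measurable_stick_ratio.
have EB j : E (\1_(B j) \o W j) = beta_law 1 al (B j).
  rewrite (_ : _ \o _ = \1_(W j @^-1` B j)); last first.
    by apply/funext => w; rewrite /= !indicE; congr (nat_of_bool _)%:R;
      apply/idP/idP => /set_mem h; exact/mem_set.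
  by rewrite exp_indic// stick_ratio_law.
rewrite [RHS](_ : _ = fine (P ([set w | forall j, (j < s)%N -> B j (W j w)] `&`
           [set w | forall j, (j < s)%N -> C j (Z j w)] `&` H))); last first.
  rewrite joint_prob// -expZ; last first.
    by apply: bmM => //; apply: bm_prod => j; exact: bum.
  apply: eq_Rintegral => w _; rewrite mulrC; congr (_ * _).
  by apply: eq_bigr => j _; rewrite EB.
rewrite -exp_indic; last first.
  have cap (F : nat -> set Om) : (forall j, measurable (F j)) ->
      measurable [set w | forall j, (j < s)%N -> F j w].
    move=> mF; rewrite [X in measurable X](_ : _ = \bigcap_(j in [set j | (j < s)%N]) F j).
      by apply: bigcap_measurableType => j _.
    by apply/seteqP; split.
  apply: measurableI => //; apply: measurableI; apply: cap => j; first exact: mWB.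
  by rewrite -[X in measurable X]setTI; apply: (mZ j) => //; exact: GC'.
have prodI (F : nat -> set Om) w : \prod_(j < s) (\1_(F j) w : R) =
    \1_[set w | forall j, (j < s)%N -> F j w] w.
  rewrite indicE; have [/set_mem Fw|nFw] := boolP (w \in _).
    by rewrite big1// => j _; rewrite indicE mem_set//; exact: Fw.
  have [j js nj] : exists2 j, (j < s)%N & ~ F j w.
    apply: contrapT => h; move: nFw; rewrite mem_set// => j js.
    by apply: contrapT => nj; apply: h; exists j.
  by rewrite (bigD1 (Ordinal js))//= indicE memNset// mul0r.
apply: eq_Rintegral => w _.
have eB := prodI (fun j => W j @^-1` B j) w.
have eC := prodI (fun j => Z j @^-1` C j) w.
rewrite !indicI -[RHS]/(\1_[set w | forall j, (j < s)%N -> B j (W j w)] w *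
  \1_[set w | forall j, (j < s)%N -> C j (Z j w)] w * \1_H w) -eB -eC.
by rewrite [RHS]mulrC -mulrA; congr (_ * _); exact: mulrC.
Qed.


Lemma ae_stick_ratio_itv : {ae P, forall w, forall j, 0 < W j w < 1}.
Proof.
apply: ae_foralln => j; exists (W j @^-1` ~` `]0, 1[%classic); split.
- rewrite -[X in measurable X]setTI; apply: measurable_stick_ratio => //.
  by apply: measurableC; exact: measurable_itv.
- have mW : measurable (W j @^-1` `]0, 1[%classic).
    by rewrite -[X in measurable X]setTI; exact: measurable_stick_ratio.
  rewrite preimage_setC; apply: (etrans (probability_setC P mW)).
  by rewrite stick_ratio_law// beta_law_itv// subee.
- by move=> w /= nW; rewrite in_itv.
Qed.

Let bpoly a b : bounded_measurable
  (fun x : R => \1_(`[0, 1]%classic : set R) x * (x ^+ a * (1 - x) ^+ b)).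
Proof.
split.
  apply: measurable_funM; first exact: measurable_indic.
  apply: measurable_funM; first exact: measurable_funX.
  by apply: measurable_funX; apply: measurable_funB => //; exact: measurable_cst.
exists 1 => x; rewrite indicE; case: (boolP (x \in _)) => [/set_mem|_].
  rewrite /= in_itv /= => /andP[x0 x1]; rewrite mul1r normrM.
  rewrite ger0_norm ?exprn_ge0// ger0_norm ?exprn_ge0 ?subr_ge0//.
  by rewrite mulr_ile1 ?exprn_ge0 ?exprn_ile1 ?subr_ge0//; lra.
by rewrite mul0r normr0.
Qed.

Let polyE a b w j :
  \1_(`[0, 1]%classic : set R) (W j w) * (W j w ^+ a * (1 - W j w) ^+ b) =
  W j w ^+ a * (1 - W j w) ^+ b.
Proof. by rewrite indicE mem_set ?mul1r//= in_itv /= stick_ratio_itv. Qed.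

Lemma exp_stick_factor s H (a b : nat -> nat) (h : SG -> R) :
  FF H -> bounded_measurable h ->
  E (fun w => \1_H w *
    \prod_(j < s) (W j w ^+ a j * (1 - W j w) ^+ b j * h (Z j w) ^+ a j)) =
  E (fun w => \1_H w *
    \prod_(j < s) (beta_moment al (a j) (b j) * um (fun x => h x ^+ a j) w)).
Proof.
move=> HF bh.
have := @exp_joint_factor s H
  (fun j x => \1_(`[0, 1]%classic : set R) x * (x ^+ a j * (1 - x) ^+ b j))
  (fun j x => h x ^+ a j) HF (fun j => bpoly _ _) (fun j => bmX _ bh).
under eq_Rintegral do under eq_bigr do rewrite polyE.
under eq_Rintegral do rewrite -mulrA -big_split.
move=> ->; apply: eq_Rintegral => w _; rewrite -mulrA -big_split /=.
congr (_ * _); apply: eq_bigr => j _; congr (_ * _).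
transitivity (E (fun w => W j w ^+ a j * (1 - W j w) ^+ b j)).
  by apply: eq_Rintegral => w' _; rewrite /= polyE.
apply: exp_beta_moment => //; first exact: measurable_stick_ratio.
  by move=> w'; exact: stick_ratio_itv.
by move=> U; exact: stick_ratio_law.
Qed.

Lemma ae_stick_breaking : {ae P, forall w, forall j,
  stick_breaking (fun i => W i w) j = V j w}.
Proof.
apply: filterS ae_stick_ratio_itv => w W01 j.
exact: (stick_invK (v := fun i => V i w)).
Qed.

Let rest J w := \prod_(j < J) (1 - W j w).

Let rest_itv J w : 0 <= rest J w <= 1.
Proof.
rewrite /rest; elim: J => [|J IH]; first by rewrite big_ord0 ler01 lexx.
rewrite big_ord_recr /=; have /andP[a b] := IH.
have /andP[u v] := stick_ratio_itv w J.
by rewrite mulr_ge0 ?subr_ge0//= mulr_ile1 ?subr_ge0//; lra.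
Qed.

Let mrest J : measurable_fun setT (rest J).
Proof.
apply: measurable_prod => j _; apply: measurable_funB; first exact: measurable_cst.
exact: measurable_stick_ratio.
Qed.

Let exp_rest J : E (rest J) = (al / (al + 1)) ^+ J.
Proof.
transitivity (E (fun w => \1_setT w *
    \prod_(j < J) (W j w ^+ 0 * (1 - W j w) ^+ 1 * 1 ^+ 0))).
  apply: eq_Rintegral => w _; rewrite indicT /cst mul1r; apply: eq_bigr => j _.
  by rewrite !expr0 expr1 mul1r mulr1.
rewrite (@exp_stick_factor J setT (fun=> 0%N) (fun=> 1%N) (fun=> 1)
  (@sigma_familyT _ _ _ _ _ _ X n) (bm_cst _ _)).
transitivity (E (fun=> (al / (al + 1)) ^+ J)); last exact: exp_cst.
apply: eq_Rintegral => w _; rewrite indicT /cst mul1r.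
rewrite big_const_ord iter_mulr_1; congr (_ ^+ _).
rewrite /beta_moment fact0 mulr1 add0n /rising !big_ord_recr !big_ord0 /= !mul1r !addr0.
rewrite (_ : um _ w = 1); last first.
  by rewrite -[RHS](urn_mean_cst1 w); congr (um _ w); apply/funext => x; rewrite expr0.
have a0 : al != 0 by rewrite gt_eqF// (lt_trans _ al1).
have a1 : al + 1 != 0 by rewrite gt_eqF// addr_gt0// (lt_trans _ al1).
by field; rewrite a0 a1.
Qed.

Let ae_rest : {ae P, forall w, rest ^~ w @ \oo --> 0}.
Proof.
have cv w : cvgn (rest ^~ w).
  apply: nonincreasing_is_cvgn; last by exists 0 => _ [J _ <-]; have /andP[] := rest_itv J w.
  apply/nonincreasing_seqP => J; rewrite /rest big_ord_recr /=.
  have /andP[a b] := rest_itv J w; have /andP[u v] := stick_ratio_itv w J.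
  by rewrite ler_piMr//; lra.
pose r w := limn (rest ^~ w).
have cr w : rest ^~ w @ \oo --> r w by exact: (cv w).
have mr : measurable_fun setT r by apply: (measurable_fun_cvg mrest) => w _; exact: cr.
have r0 w : 0 <= r w.
  by apply: limr_ge; [exact: cv|apply: nearW => J; have /andP[] := rest_itv J w].
have r1 w : r w <= 1.
  by apply: limr_le; [exact: cv|apply: nearW => J; have /andP[] := rest_itv J w].
have c1 : (fun J => E (rest J)) @ \oo --> E r.
  apply: (@exp_cvg _ _ _ _ _ _ 1) => //; last exact: aeW.
  by move=> J w; have /andP[a b] := rest_itv J w; rewrite ger0_norm.
have c0 : (fun J => E (rest J)) @ \oo --> 0.
  under eq_fun do rewrite exp_rest.
  apply: cvg_expr; have a0 := lt_trans ltr01 al1.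
  have a1 : 0 < al + 1 by rewrite addr_gt0.
  have q0 : 0 <= al / (al + 1) by apply: divr_ge0; exact: ltW.
  by rewrite (ger0_norm q0) ltr_pdivrMr// mul1r ltrDl.
have Er : E r = 0 by exact: (cvg_unique _ c1 c0).
have br : bounded_measurable r by split=> //; exists 1 => w; rewrite ger0_norm.
apply: filterS (exp_eq0 (bm_integrable P br) r0 Er) => w rw.
by rewrite -rw; exact: cr.
Qed.

Lemma ae_stick_weights : {ae P, forall w, (forall j, 0 <= V j w) /\
  (fun J => \sum_(j < J) V j w) @ \oo --> (1 : R)}.
Proof.
apply: filterS2 ae_stick_breaking ae_rest => w VE rw; split=> [j|].
  rewrite -VE /stick_breaking; have /andP[a _] := stick_ratio_itv w j.
  by have /andP[b _] := rest_itv j w; rewrite mulr_ge0.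
rewrite (_ : (fun J => _) = (fun J => 1 - rest J w)); last first.
  apply/funext => J; rewrite /rest -stick_breaking_sum opprB addrC subrK.
  by apply: eq_bigr => j _; rewrite VE.
by rewrite -[X in _ --> X]subr0; apply: cvgB => //; exact: cvg_cst.
Qed.

End stick_urn.

Lemma cond_prob_ae_le d (Om : measurableType d) (R : realType)
    (P : probability Om R) (F : set (set Om)) (D D' : set Om) (f g : Om -> R) :
  F `<=` measurable -> sigma_algebra setT F ->
  (forall H, F H -> P (D `&` H) = P (D' `&` H)) ->
  cond_prob P F D f -> cond_prob P F D' g -> {ae P, forall w, f w <= g w}.
Proof.
move=> Fm sF DD' [mf fi fE] [mg gi gE].
pose T := g_sigma_algebraType F.
have mT (k : Om -> R) : measurable_wrt F k -> measurable_fun setT (k : T -> R).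
  move=> mk _ B mB; rewrite (measurable_sub_sigma sF); apply: mk.
  by exists B.
pose H := [set w | g w < f w].
have FH : F H.
  rewrite -(measurable_sub_sigma sF).
  rewrite [X in measurable X](_ : _ = [set w : T | g w - f w < 0]).
    by apply: measurable_lt_set; apply: measurable_funB; exact: mT.
  by apply/seteqP; split => w; rewrite /H /= subr_lt0.
have mH : measurable H by exact: Fm.
have fiH : P.-integrable H (EFin \o f) by exact: integrableS fi.
have giH : P.-integrable H (EFin \o g) by exact: integrableS gi.
have i0 : (\int[P]_(w in H) ((f w)%:E - (g w)%:E) = 0)%E.
  have fin : P (D' `&` H) \is a fin_num.
    by rewrite -gE//; exact: integrable_fin_num.
  by rewrite integralB_EFin// fE// gE// DD'// subee.
have /(ae_eq_integral_abs P mH) [+ _] : measurable_fun H (fun w => (f w)%:E - (g w)%:E)%E.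
  by apply: emeasurable_funB; [exact: measurable_int fiH|exact: measurable_int giH].
have -> : (\int[P]_(w in H) `|(f w)%:E - (g w)%:E| =
    \int[P]_(w in H) ((f w)%:E - (g w)%:E))%E.
  apply: eq_integral => w /set_mem Hw; rewrite gee0_abs// -EFinB lee_fin subr_ge0.
  exact: ltW.
move=> /(_ i0); apply: filterS => w h; rewrite leNgt; apply/negP => gf.
by move: (h gf) => /eqP; rewrite /= -EFinB eqe subr_eq0 gt_eqF.
Qed.

Section mixture_random.
Context dS (S : measurableType dS) (R : realType).

Definition weights (v : nat -> R) : Prop :=
  (forall j, 0 <= v j) /\ (\sum_(0 <= j <oo) (v j)%:E = 1)%E.

Lemma mixture_default (v : nat -> R) (q : nat -> probability S R) :
  ~ weights v -> mixture v q = q 0%N.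
Proof.
move=> nw; apply: xgetPN => p [v0 pE]; apply: nw; split=> //.
have := pE _ measurableT; rewrite probability_setT => ->.
by apply: eq_eseriesr => j _; rewrite probability_setT mule1.
Qed.

Lemma nneseries_cvg (u : nat -> R) (l : R) :
  (fun J => \sum_(j < J) u j) @ \oo --> l -> (\sum_(0 <= j <oo) (u j)%:E = l%:E)%E.
Proof.
move=> ul; apply/cvg_lim => //.
have -> : (fun n => \sum_(0 <= j < n) (u j)%:E)%E = EFin \o (fun J => \sum_(j < J) u j).
  by apply/funext => J; rewrite /= sumEFin big_mkord.
by apply/fine_cvgP; split; [exact: nearW|exact: ul].
Qed.

Lemma mixture_cvg (v : nat -> R) (q : nat -> probability S R) A :
  (forall j, 0 <= v j) -> (fun J => \sum_(j < J) v j) @ \oo --> (1 : R) ->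
  measurable A ->
  (fun J => \sum_(j < J) v j * fine (q j A)) @ \oo --> fine (mixture v q A).
Proof.
move=> v0 v1 mA; have q01 j := fine_probability_itv (q j) mA.
have cv : cvgn (fun J => \sum_(j < J) v j * fine (q j A)).
  apply: nondecreasing_is_cvgn.
    apply/nondecreasing_seqP => J; rewrite big_ord_recr /= lerDl.
    by have /andP[a _] := q01 J; rewrite mulr_ge0.
  exists 1 => _ [J _ <-].
  apply: (@le_trans _ _ (\sum_(j < J) v j)).
    by apply: ler_sum => j _; have /andP[a b] := q01 j; rewrite ler_piMr.
  have nd : nondecreasing_seq (fun J => \sum_(j < J) v j).
    by apply/nondecreasing_seqP => k; rewrite big_ord_recr /= lerDl.
  have c1 : cvgn (fun J => \sum_(j < J) v j) by apply/cvg_ex; exists 1.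
  by have := nondecreasing_cvgn_le nd c1 J; rewrite (cvg_lim _ v1).
have e := mixtureE q v0 (nneseries_cvg v1) mA.
have -> : fine (mixture v q A) = limn (fun J => \sum_(j < J) v j * fine (q j A)).
  rewrite e -[RHS]/(fine (limn (fun J => \sum_(j < J) v j * fine (q j A)))%:E).
  have e' := nneseries_cvg (u := fun j => v j * fine (q j A)) cv; congr fine; apply: etrans e'.
  by apply: eq_eseriesr => j _; rewrite EFinM fineK// fin_num_measure.
exact: cv.
Qed.

Context d (Om : measurableType d) (P : probability Om R).

Lemma measurable_mixture (V : nat -> Om -> R) (Q : nat -> Om -> pprobability S R) :
  (forall j, measurable_fun setT (V j)) -> (forall j, measurable_fun setT (Q j)) ->
  measurable_fun setT ((fun w => mixture (fun j => V j w) (fun j => Q j w)) :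
    Om -> pprobability S R).
Proof.
move=> mV mQ; apply: measurable_pprobability => A mA.
pose Vp j w := Num.max 0 (V j w).
have mVp j : measurable_fun setT (Vp j).
  by apply: measurable_maxr => //; exact: measurable_cst.
have mQA j : measurable_fun setT (fun w => Q j w A).
  exact: (measurable_kernel (kprobability (mQ j)) A mA).
have msum (h : nat -> Om -> \bar R) : (forall j w, (0 <= h j w)%E) ->
    (forall j, measurable_fun setT (h j)) ->
    measurable_fun setT (fun w => \sum_(0 <= j <oo) h j w)%E.
  by move=> h0 mh; apply: (ge0_emeasurable_sum (P := xpredT)).
have Vp0 j w : 0 <= Vp j w by rewrite /Vp le_max lexx.
pose good w := `[< weights (fun j => V j w) >].
have mgood : measurable_fun setT good.
  apply: (measurable_fun_bool true); rewrite setTI.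
  rewrite [X in measurable X](_ : _ = (\bigcap_j (V j @^-1` `[0, +oo[%classic)) `&`
      ((fun w => \sum_(0 <= j <oo) (Vp j w)%:E)%E @^-1` [set 1%E])).
    apply: measurableI.
      apply: bigcapT_measurable => j; rewrite -[X in measurable X]setTI.
      by apply: mV => //; exact: measurable_itv.
    rewrite -[X in measurable X]setTI; apply: msum => //.
    by move=> j; exact/measurable_EFinP.
  apply/seteqP; split => w /=.
    move=> /asboolP [v0 v1]; split; first by move=> j _; rewrite /= in_itv /= v0.
    by rewrite -v1; apply: eq_eseriesr => j _; rewrite /Vp max_r.
  move=> [v0 v1]; have v0' j : 0 <= V j w by have := v0 j I; rewrite /= in_itv /= andbT.
  apply/asboolP; split=> //.
  by rewrite -v1; apply: eq_eseriesr => j _; rewrite /Vp max_r.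
have -> : (fun w => fine (mixture (fun j => V j w) (fun j => Q j w) A)) =
    (fun w => if good w then fine (\sum_(0 <= j <oo) (Vp j w)%:E * Q j w A)%E
              else fine (Q 0%N w A)).
  apply/funext => w; rewrite /good; case: asboolP => [[v0 v1]|nw].
    rewrite mixtureE//; congr fine; apply: eq_eseriesr => j _.
    by rewrite /Vp max_r.
  by rewrite mixture_default.
apply: measurable_fun_ifT => //; last exact: measurableT_comp.
apply: measurableT_comp => //; apply: msum.
- by move=> j w; rewrite mule_ge0 ?lee_fin.
- by move=> j; apply: emeasurable_funM => //; exact/measurable_EFinP.
Qed.

End mixture_random.

(** * The posterior law *)

Section posterior.
Context d (Om : measurableType d) (R : realType) (P : probability Om R)
  dS (S : measurableType dS) (X : nat -> {RV P >-> S}) (nu : probability S R)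
  (theta : R) (K : {mfun S >-> pprobability S R}) (G : set (set S)).
Local Notation E f := (\int[P]_w f w).
Hypotheses (theta0 : 0 < theta) (sG : sigma_algebra setT G) (Gm : G `<=` measurable)
  (rK : regular_cond_distr nu G K)
  (X0 : forall A, measurable A -> P (X 0%N @^-1` A) = nu A)
  (XP : forall n A, (0 < n)%N -> measurable A ->
    cond_prob P (sigma_family `I_n X) (X n @^-1` A)
      (fun w => predictive nu theta K X n w A)).
Local Notation SG := (g_sigma_algebraType G).
Local Notation I := {A : set S | measurable A}.

Definition avg (c : seq I) (f : set S -> R) : R :=
  (size c).+1%:R^-1 * \sum_(i <- c) f (sval i).

Lemma avg_itv c f : (forall i : I, 0 <= f (sval i) <= 1) -> 0 <= avg c f <= 1.
Proof.
move=> f01; have f0 (i : I) : 0 <= f (sval i) by have /andP[] := f01 i.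
rewrite /avg mulr_ge0 ?invr_ge0 ?sumr_ge0//= mulrC ler_pdivrMr ?ltr0n// mul1r.
apply: (@le_trans _ _ (\sum_(i <- c) 1)).
  by apply: ler_sum => i _; have /andP[] := f01 i.
by rewrite big_const_seq count_predT iter_addr_0 ler_nat.
Qed.

Lemma avg_cvg c (f : nat -> set S -> R) g :
  (forall i : I, (fun N => f N (sval i)) @ \oo --> g (sval i)) ->
  (fun N => avg c (f N)) @ \oo --> avg c g.
Proof.
move=> fg; apply: cvgMl_tmp.
exact: (@cvg_sumr R _ c (fun i N => f N (sval i)) (fun i => g (sval i))).
Qed.

Lemma bm_avg c (f : Om -> set S -> R) :
  (forall i : I, bounded_measurable (fun w => f w (sval i))) ->
  bounded_measurable (fun w => avg c (f w)).
Proof. by move=> bf; apply: bmZ; exact: bm_sum. Qed.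

Local Notation h c := (fun x : SG => avg c (fun A => fine (K x A))).

Let h_itv c (x : SG) : 0 <= h c x <= 1.
Proof. by apply: avg_itv => i; apply: fine_probability_itv; exact: svalP i. Qed.

Let bh c : bounded_measurable (h c).
Proof.
apply: bmZ; apply: bm_sum => i.
have mi : measurable (sval i) := svalP i; split.
  apply: measurableT_comp => //= _ B mB; rewrite (measurable_sub_sigma sG).
  by apply: rK.1 mi _ _; exists B.
by exists 1 => x; have /andP[a b] := fine_probability_itv (K x) mi; rewrite ger0_norm.
Qed.

Let cs c j : R := theta * E (fun w => h c (X 0%N w) ^+ j).
Local Notation Y c := (fun i w => h c (X i w)).
Local Notation p c := (urn_power_sum (Y c) (cs c)).
Local Notation um := (@urn_mean d Om R P dS S X theta G).

Let mXG i : measurable_fun setT (X i : Om -> SG).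
Proof. by apply: measurable_fun_sub. Qed.

Let bY c i : bounded_measurable (Y c i).
Proof. exact: (bm_comp (mXG i) (bh c)). Qed.

Let cs0 c : cs c 0%N = theta.
Proof.
rewrite /cs; under eq_Rintegral do rewrite expr0.
by rewrite exp_cst mulr1.
Qed.

Let cs_itv c j : 0 <= cs c j <= cs c 0%N.
Proof.
have e0 : 0 <= E (fun w => h c (X 0%N w) ^+ j).
  by apply: Rintegral_ge0 => w _; rewrite exprn_ge0//; have /andP[] := h_itv c (X 0%N w).
rewrite cs0 /cs mulr_ge0 ?(ltW theta0)//= ler_piMr ?(ltW theta0)//.
apply: (le_trans (ler_norm _)); apply: exp_normr_le => [|w]; first exact: bmX.
have /andP[a b] := h_itv c (X 0%N w).
by rewrite ger0_norm ?exprn_ge0// exprn_ile1.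
Qed.

Let power_sumE c N w j : p c N w j = (N%:R + theta) * um N (fun x => h c x ^+ j) w.
Proof.
rewrite /urn_power_sum /urn_mean mulrCA divff ?mulr1//.
by rewrite gt_eqF// ltr_wpDl.
Qed.

Lemma limit_moment (m : Om -> pprobability S R) n H c k :
  measurable_fun setT m ->
  (forall A, measurable A ->
    {ae P, forall w, (fun N => predictive nu theta K X N w A) @ \oo --> fine (m w A)}) ->
  (0 < n)%N -> sigma_family `I_n X H ->
  E (fun w => \1_H w * avg c (fun A => fine (m w A)) ^+ k) =
  E (fun w => \1_H w * (k`!%:R * csym (p c n w) k / rising (cs c 0%N + n%:R) k)).
Proof.
move=> mm mP n0 HF.
apply: (@urn_limit_moment _ _ _ P (@adapted _ _ _ P _ _ X)).
- by move=> N f; exact: adapted_bm.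
- by move=> N b; exact: bm_cst.
- by move=> N f g; exact: bmD.
- by move=> N f g; exact: bmM.
- by move=> N i iN; exact: (adapted_X X sG Gm iN (bh c)).
- by move=> N nN; apply: adapted_indic; exact: (sigma_family_le nN).
- by move=> i w; exact: h_itv.
- by rewrite cs0.
- exact: cs_itv.
- move=> N j f nN af; rewrite cs0 addrC.
  have N0 : (0 < N)%N by exact: leq_trans nN.
  have bf := adapted_bm af.
  have [bum _ _ _] := bounded_operator_urn_mean X theta0 sG Gm N.
  have bu := bum _ (bmX j (bh c)).
  rewrite (exp_urn theta0 sG Gm rK X0 XP N0 (bmX j (bh c)) af) -expZ; last exact: bmM.
  by apply: eq_Rintegral => w _; rewrite power_sumE mulrCA.
- have [] // : bounded_measurable (fun w => avg c (fun A => fine (m w A))).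
  apply: bm_avg => i; have mi : measurable (sval i) := svalP i.
  split; first exact: measurable_pprobability_eval.
  by exists 1 => w; have /andP[a b] := fine_probability_itv (m w) mi; rewrite ger0_norm.
have : {ae P, forall w, forall i, i \in iota 0 (size c) ->
    (fun N => predictive nu theta K X N w (nth setT (map sval c) i)) @ \oo -->
    fine (m w (nth setT (map sval c) i))}.
  apply: ae_foralln => i; have [ic|ic] := ltnP i (size c).
    have mi : measurable (nth setT (map sval c) i).
      elim: (c) i {ic} => [|a l IH] i; first by rewrite nth_nil; exact: measurableT.
      by case: i => [|i] /=; [exact: (svalP a)|exact: IH].
    by apply: filterS (mP _ mi) => w.
  by apply: aeW => w; rewrite mem_iota add0n ltnNge ic.
apply: filterS => w wP.
have pE N : p c N w 1%N / (cs c 0%N + N%:R) =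
    (size c).+1%:R^-1 * \sum_(i < size c)
      predictive nu theta K X N w (nth setT (map sval c) i).
  rewrite cs0 addrC power_sumE mulrAC divff ?mul1r; last first.
    by rewrite gt_eqF// ltr_wpDl.
  rewrite /urn_mean /predictive -mulr_suml mulrA; congr (_ / _).
  rewrite big_split /= mulrDr.
  have sumE (F : set S -> R) : \sum_(j < size c) F (nth setT (map sval c) j) =
      \sum_(i <- c) F (sval i).
    rewrite -(big_map sval xpredT F) (big_nth setT) size_map big_mkord.
    by [].
  congr (_ + _); last first.
    rewrite exchange_big /= mulr_sumr; apply: eq_bigr => i _; rewrite expr1 /avg; congr (_ * _).
    by rewrite (sumE (fun A => fine (K (X i w) A))).
  rewrite -mulr_sumr (sumE (fun A => fine (nu A))) mulrCA; congr (_ * _).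
  transitivity (E (fun w => avg c (fun A => fine (K (X 0%N w) A)))).
    by apply: eq_Rintegral => w' _; rewrite /= expr1.
  rewrite /avg expZ; last first.
    by apply: bm_sum => i; apply: bm_eval => //; exact: (svalP i).
  congr (_ * _); rewrite exp_sum => [|i]; last first.
    by apply: bm_eval => //; exact: (svalP i).
  by apply: eq_bigr => i _; rewrite (exp_kernel_X0 sG rK X0)//; exact: (svalP i).
rewrite (_ : (fun N => p c N w 1%N / (cs c 0%N + N%:R)) = (fun N =>
    (size c).+1%:R^-1 * \sum_(i < size c)
      predictive nu theta K X N w (nth setT (map sval c) i))); last first.
  by apply/funext => N; exact: pE.
have -> : avg c (fun A => fine (m w A)) = (size c).+1%:R^-1 *
    \sum_(i < size c) fine (m w (nth setT (map sval c) i)).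
  congr (_ * _).
  by rewrite -(big_map sval xpredT (fun A => fine (m w A))) (big_nth setT) size_map big_mkord.
apply: cvgMl_tmp.
apply: (@cvg_sumr R _ _ (fun (i : 'I_(size c)) N =>
  predictive nu theta K X N w (nth setT (map sval c) i))
  (fun i => fine (m w (nth setT (map sval c) i)))) => i.
by apply: wP; rewrite mem_iota /= add0n.
Qed.

Variables (n : nat) (V : nat -> {RV P >-> R}) (Z : nat -> {RV P >-> S}).
Hypotheses (n0 : (0 < n)%N)
  (VZ_indep : cond_indep_sigma P (sigma_family `I_n X)
    (sigma_family setT V) (sigma_family setT Z))
  (V_law : exists2 L, stick_breaking_law (n%:R + theta) L &
    forall B, product_sigma B ->
      cond_prob P (sigma_family `I_n X) [set w | B (fun j => V j w)] (fun=> L B))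
  (Z_indep : cond_mutual_indep P (sigma_family `I_n X) Z)
  (Z_law : forall j A, measurable A ->
    cond_prob P (sigma_family `I_n X) (Z j @^-1` A)
      (fun w => predictive nu theta K X n w A)).

Definition stick_mixture (w : Om) : pprobability S R :=
  mixture (fun j => V j w) (fun j => K (Z j w)).

Lemma measurable_stick_mixture : measurable_fun setT stick_mixture.
Proof.
apply: (measurable_mixture (V := fun j w => V j w) (Q := fun j w => K (Z j w))) => // j.
exact: measurableT_comp.
Qed.

Let al1 : 1 < n%:R + theta.
Proof. by rewrite ltr_pwDr// ler1n. Qed.

Lemma stick_moment H c k : sigma_family `I_n X H ->
  E (fun w => \1_H w * avg c (fun A => fine (stick_mixture w A)) ^+ k) =
  E (fun w => \1_H w * (k`!%:R * csym (p c n w) k / rising (cs c 0%N + n%:R) k)).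
Proof.
move=> HF; rewrite cs0 addrC.
have mZ j : measurable_fun setT (Z j : Om -> SG) by apply: measurable_fun_sub.
have ppE w : p c n w 0%N = n%:R + theta.
  by rewrite power_sum0 cs0 addrC.
apply: (@stick_limit_moment _ _ _ P (stick_ratio V) (fun j w => h c (Z j w))).
- by move=> i w; exact: stick_ratio_itv.
- by move=> i w; exact: h_itv.
- by move=> i; exact: measurable_stick_ratio.
- by move=> i; have [] := bm_comp (mZ i) (bh c).
- exact: lt_trans al1.
- exact: ppE.
- move=> w j; rewrite -(ppE w); apply: power_sum_itv; last exact: cs_itv.
  by move=> i w'; exact: h_itv.
- move=> j; have [] // : bounded_measurable ((p c n) ^~ j).
  apply: bmD; first exact: bm_cst.
  by apply: bm_sum => i; apply: bmX; exact: bY.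
- by apply: bm_indic; exact: (sub_sigma_family HF).
- move=> s a b.
  rewrite (exp_stick_factor theta0 sG Gm rK X0 XP n0 VZ_indep V_law Z_indep Z_law
    s a b HF (bh c)).
  apply: eq_Rintegral => w _; congr (_ * _); by apply: eq_bigr => j _; congr (_ * _).
- have [] // : bounded_measurable (fun w => avg c (fun A => fine (stick_mixture w A))).
  apply: bm_avg => i; have mi : measurable (sval i) := svalP i.
  split; first by apply: measurable_pprobability_eval => //; exact: measurable_stick_mixture.
  by exists 1 => w; have /andP[x y] := fine_probability_itv (stick_mixture w) mi;
    rewrite ger0_norm.
have aeb := ae_stick_breaking theta0 sG Gm rK X0 XP n0 VZ_indep V_law Z_indep Z_law.
have aew := ae_stick_weights theta0 sG Gm rK X0 XP n0 VZ_indep V_law Z_indep Z_law.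
apply: filterS2 aeb aew => w VE [v0 v1].
rewrite (_ : (fun J => _) = (fun J => avg c (fun A => \sum_(j < J) V j w * fine (K (Z j w) A)))).
  by apply: avg_cvg => i; apply: mixture_cvg => //; exact: (svalP i).
apply/funext => J; rewrite stick_sumE /avg.
rewrite exchange_big /= mulr_sumr; apply: eq_bigr => j _.
by rewrite VE -mulr_sumr mulrCA.
Qed.

Lemma posterior_law (m : Om -> pprobability S R) H C :
  measurable_fun setT m ->
  (forall A, measurable A ->
    {ae P, forall w, (fun N => predictive nu theta K X N w A) @ \oo --> fine (m w A)}) ->
  sigma_family `I_n X H -> measurable C ->
  P (m @^-1` C `&` H) = P (stick_mixture @^-1` C `&` H).
Proof.
move=> mm mP HF; have mH := sub_sigma_family HF.
have ms := measurable_stick_mixture.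
have bH : bounded_measurable (\1_H : Om -> R) by exact: bm_indic.
pose x (i : I) w := fine (m w (sval i)).
pose x' (i : I) w := fine (stick_mixture w (sval i)).
have x01 i w : 0 <= x i w <= 1 by apply: fine_probability_itv; exact: (svalP i).
have x'01 i w : 0 <= x' i w <= 1 by apply: fine_probability_itv; exact: (svalP i).
have bx i : bounded_measurable (x i).
  split; first by apply: measurable_pprobability_eval => //; exact: (svalP i).
  by exists 1 => w; have /andP[a b] := x01 i w; rewrite ger0_norm.
have bx' i : bounded_measurable (x' i).
  split; first by apply: measurable_pprobability_eval => //; exact: (svalP i).
  by exists 1 => w; have /andP[a b] := x'01 i w; rewrite ger0_norm.
have sums c k : E (fun w => \1_H w * (\sum_(i <- c) x i w) ^+ k) =
    E (fun w => \1_H w * (\sum_(i <- c) x' i w) ^+ k).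
  have scale (y : I -> Om -> R) (m' : Om -> pprobability S R) :
      (forall i w, y i w = fine (m' w (sval i))) -> (forall i, bounded_measurable (y i)) ->
      E (fun w => \1_H w * (\sum_(i <- c) y i w) ^+ k) = (size c).+1%:R ^+ k *
      E (fun w => \1_H w * avg c (fun A => fine (m' w A)) ^+ k).
    move=> yE yB; rewrite -expZ.
      apply: eq_Rintegral => w _; rewrite mulrCA -exprMn; congr (_ * _ ^+ _).
      by rewrite /avg mulrA divff ?pnatr_eq0// mul1r; apply: eq_bigr => i _; rewrite yE.
    apply: bmM => //; apply: bmX; apply: bmZ; apply: bm_sum => i.
    by under eq_fun do rewrite -yE; exact: yB.
  rewrite (scale x m)// (scale x' stick_mixture)//; congr (_ * _).
  by rewrite (limit_moment c k mm mP n0 HF) stick_moment.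
have joint := eq_joint_moments bH bx bx' sums.
have cdf := eq_joint_cdf bH bx bx' x01 x'01 joint.
pose box (s : seq (I * R)) : set (pprobability S R) :=
  [set q | all (fun t => fine ((q : probability S R) (sval t.1)) < t.2) s].
pose Gbox := [set box s | s in setT].
have mbox s : measurable (box s).
  elim: s => [|t s IH]; first by rewrite [box _](_ : _ = setT)//; apply/seteqP; split.
  rewrite [box _](_ : _ = [set q : pprobability S R |
      fine ((q : probability S R) (sval t.1)) < t.2] `&` box s).
    apply: measurableI => //; apply: measurable_lt_set.
    by apply: (measurable_pprobability_eval (m := id)) => //; exact: (svalP t.1).
  by apply/seteqP; split => q /=; [move=> /andP[]|move=> [a b]; apply/andP].
move=> mC; apply: (dynkin_eq_prob (G := Gbox)) => //.
- move=> _ _ [s _ <-] [t _ <-]; exists (s ++ t) => //.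
  by apply/seteqP; split => q; rewrite /box /= all_cat; [move=> /andP[]|move=> [a b]; apply/andP].
- by move=> _ [s _ <-].
- move=> _ [s _ <-].
  have boxE (m' : Om -> pprobability S R) (y : I -> Om -> R) :
      (forall i w, y i w = fine (m' w (sval i))) -> measurable_fun setT m' ->
      fine (P (m' @^-1` box s `&` H)) =
      E (fun w => \1_H w * \prod_(t <- s) \1_[set w | y t.1 w < t.2] w).
    move=> yE mm'; rewrite -exp_indic; last first.
      by apply: measurableI => //; rewrite -[_ @^-1` _]setTI; exact: mm'.
    apply: eq_Rintegral => w _; rewrite indicI mulrC; congr (_ * _).
    rewrite /box; elim: s => [|t s IH].
      by rewrite big_nil indicE mem_set.
    rewrite big_cons -IH !indicE -natrM mulnb; congr (nat_of_bool _)%:R.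
    apply/idP/andP => [/set_mem /= /andP[a b]|[/set_mem /= a /set_mem /= b]].
      by split; apply/mem_set => //=; rewrite yE.
    by apply/mem_set => /=; rewrite -yE a b.
  have fin (m' : Om -> pprobability S R) : measurable_fun setT m' ->
      P (m' @^-1` box s `&` H) \is a fin_num.
    move=> mm'; apply: fin_num_measure; apply: measurableI => //.
    by rewrite -[_ @^-1` _]setTI; exact: mm'.
  rewrite -[LHS]fineK ?fin// -[RHS]fineK ?fin//; congr (_%:E).
  by rewrite (boxE m x)// (boxE stick_mixture x').
suff sub : <<s @pset _ S R >> `<=` <<s Gbox >> by exact: sub.
apply: smallest_sub; first exact: smallest_sigma_algebra.
move=> _ [r _] [A mA <-]; apply: sub_sigma_algebra.
exists [:: (exist _ A mA, r)] => //; apply/seteqP.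
by split => q; rewrite /box /mset /= andbT -lte_fin fineK ?fin_num_measure.
Qed.

End posterior.

Unset Implicit Arguments.
Set Strict Implicit.

Theorem theorem13 (R : realType)
  (T : topologicalType) (hT : polish R T)
  (S : set T) (hS : <<s @open T >> S) (s0 : set_type S)
  (d : measure_display) (Om : measurableType d) (P : probability Om R)
  (X : nat -> {RV P >-> borel_subset s0})
  (nu : probability (borel_subset s0) R) (theta : R)
  (K : {mfun borel_subset s0 >-> pprobability (borel_subset s0) R})
  (hX : class_L P nu theta K X)
  (mu : {RV P >-> pprobability (borel_subset s0) R})
  (mu_empirical : forall A : set (borel_subset s0), measurable A ->
    {ae P, forall w,
      (fun n : nat => (\sum_(i < n) \1_A (X i w)) / n%:R : R) @ \oo
        --> fine ((mu w : probability (borel_subset s0) R) A)})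
  (mu_predictive : forall (A : set (borel_subset s0)) (g : nat -> Om -> R),
    measurable A ->
    (forall n, (0 < n)%N ->
       cond_prob P (sigma_family `I_n X) (X n @^-1` A) (g n)) ->
    {ae P, forall w, (fun n : nat => g n w) @ \oo
        --> fine ((mu w : probability (borel_subset s0) R) A)})
  (V : nat -> nat -> {RV P >-> R})
  (Z : nat -> nat -> {RV P >-> borel_subset s0})
  (VZ_indep : forall n, (0 < n)%N ->
    cond_indep_sigma P (sigma_family `I_n X)
      (sigma_family setT (V n)) (sigma_family setT (Z n)))
  (V_law : forall n, (0 < n)%N ->
    exists2 L, stick_breaking_law (n%:R + theta) L &
      forall B, product_sigma B ->
        cond_prob P (sigma_family `I_n X)
          [set w | B (fun j => V n j w)] (fun=> L B))
  (Z_indep : forall n, (0 < n)%N ->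
    cond_mutual_indep P (sigma_family `I_n X) (Z n))
  (Z_law : forall n j A, (0 < n)%N -> measurable A ->
    cond_prob P (sigma_family `I_n X) (Z n j @^-1` A)
      (fun w => predictive nu theta K X n w A)) :
  let mustar (n : nat) (w : Om) : pprobability (borel_subset s0) R :=
    mixture (fun j => V n j w) (fun j => K (Z n j w)) in
  forall (n : nat) (C : set (pprobability (borel_subset s0) R)),
    (0 < n)%N -> measurable C ->
    forall f g : Om -> R,
      cond_prob P (sigma_family `I_n X) (mu @^-1` C) f ->
      cond_prob P (sigma_family `I_n X) (mustar n @^-1` C) g ->
      {ae P, forall w, f w = g w}.
Proof.
move=> mustar n C n0 mC f g cf cg.
have [theta0 [G [sG Gm rK]] X0 XP] := hX.
have mP (A : set (borel_subset s0)) : measurable A ->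
    {ae P, forall w, (fun N => predictive nu theta K X N w A) @ \oo -->
      fine ((mu w : probability (borel_subset s0) R) A)}.
  by move=> mA; apply: mu_predictive => // N N0; exact: XP.
have law H : sigma_family `I_n X H ->
    P (mu @^-1` C `&` H) = P (mustar n @^-1` C `&` H).
  move=> HF; apply: (posterior_law theta0 sG Gm rK X0 XP n0 (VZ_indep n n0)
    (V_law n n0) (Z_indep n n0) (fun j A => Z_law n j A n0) _ mP HF mC).
  exact: measurable_funP.
have Fm : sigma_family `I_n X `<=` measurable by exact: (@sub_sigma_family _ _ _ _ _ _ X n).
have sF : sigma_algebra setT (sigma_family `I_n X) by exact: smallest_sigma_algebra.
have fg := cond_prob_ae_le Fm sF law cf cg.
have gf := cond_prob_ae_le Fm sF (fun H HF => esym (law H HF)) cg cf.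
by apply: filterS2 fg gf => w a b; apply/eqP; rewrite eq_le a b.
Qed.
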